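(* Let $n\ge2$ and let $\mathbb{S}^n$ be the unit sphere with its canonical metric. For any non-zero Killing vector field $\xi$ on $\mathbb{S}^n$, there exists a Kaluza-Klein metric $G$ on $T\mathbb{S}^n$ (with $A$ not necessarily constant) making $\xi:\mathbb{S}^n\to(T\mathbb{S}^n,G)$ into a harmonic section, and such that: if $n=2$, then $\xi$ is also a harmonic map into $(T\mathbb{S}^n,G)$; if $n=2p$ with $p>1$, then $\xi$ is not a harmonic map into $(T\mathbb{S}^n,G)$; if $n=2p+1$, then $\xi$ is not a harmonic map into $(T\mathbb{S}^n,G)$ unless $\xi$ has constant norm.
   Context: Let $(M,g)$ be a Riemannian manifold with Levi-Civita connection $\nabla$. At $(p,e)\in TM$ the space $T_{(p,e)}TM$ splits into the vertical space (kernel of $d\pi$, $\pi:TM\to M$ the projection) and the horizontal space defined by $\nabla$; each $X\in T_pM$ has a horizontal lift $X^h$ and a vertical lift $X^v$. A Kaluza-Klein metric on $TM$ is a Riemannian metric $G$ such that at $(p,e)$ $$G(X^h,Y^h)=A(|e|^2)g(X,Y),\quad G(X^h,Y^v)=0,\quad G(X^v,Y^v)=B(|e|^2)g(X,Y)+C(|e|^2)g(X,e)g(Y,e),$$ where $A,B,C$ are real $C^2$ functions on $[0,\infty)$, $A>0$, and $B,C$ are such that $G$ is positive definite. Here $A$ is not required to be constant. A vector field $\sigma$ on $M$ is viewed as a map $\sigma:(M,g)\to(TM,G)$. Its tension field $\tau(\sigma)=\operatorname{trace}\nabla d\sigma$ (computed with the Levi-Civita connections of $g$ and $G$) is decomposed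 as $\tau(\sigma)=[\tau^h(\sigma)]^h+[\tau^v(\sigma)]^v$ with $\tau^h(\sigma),\tau^v(\sigma)$ vector fields on $M$. $\sigma$ is a harmonic map if $\tau(\sigma)=0$, and a harmonic section if $\tau^v(\sigma)=0$. *)

(* Defs.v *)
(* Vector fields, metrics and maps are handled through their coordinate
   expressions.  S^n is covered by its two stereographic charts, each of which
   has all of R^n as coordinate domain, and T S^n by the two induced charts. *)
From HB Require Import structures.
From mathcomp Require Import all_boot all_order all_algebra.
From mathcomp Require Import all_classical all_reals.
From mathcomp Require Import topology normedtype derive.
From mathcomp Require Import ring.

Set Implicit Arguments.
Unset Strict Implicit.
Unset Printing Implicit Defensive.

Import Order.TTheory GRing.Theory Num.Theory.
Import numFieldNormedType.Exports.

Local Open Scope classical_set_scope.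
Local Open Scope ring_scope.

Section Coordinates.
Context {R : realType}.

Definition partial m (i : 'I_m) (f : 'rV[R]_m -> R^o) (x : 'rV[R]_m) : R :=
  'D_(delta_mx 0 i) f x.

Fixpoint is_Ck (k m : nat) (f : 'rV[R]_m -> R^o) : Prop :=
  if k is k'.+1 then
    (forall x, differentiable f x) /\ (forall i, is_Ck k' (partial i f))
  else continuous f.

Definition smooth m (f : 'rV[R]_m -> R^o) : Prop := forall k, is_Ck k f.

Definition form m (S : 'M[R]_m) (X Y : 'rV[R]_m) : R := (X *m S *m Y^T) 0 0.

Definition riemannian m (h : 'rV[R]_m -> 'M[R]_m) : Prop :=
  forall x, (h x)^T = h x /\ forall X, X != 0 -> 0 < form (h x) X X.

(* The component Gamma^k_ij of the Levi-Civita connection of h. *)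
Definition christoffel m (h : 'rV[R]_m -> 'M[R]_m) (k i j : 'I_m)
    (x : 'rV[R]_m) : R :=
  2^-1 * \sum_l invmx (h x) k l *
    (partial i (fun z => h z j l) x + partial j (fun z => h z i l) x
     - partial l (fun z => h z i j) x).

Lemma christoffel_torsion_free m (h : 'rV[R]_m -> 'M[R]_m) k i j x :
  (forall z, (h z)^T = h z) -> christoffel h k i j x = christoffel h k j i x.
Proof.
move=> hT; rewrite /christoffel; congr (_ * _); apply: eq_bigr => l _.
congr (_ * _); rewrite [X in X - _]addrC; congr (_ - partial l _ x).
by apply/funext => z; rewrite -[in LHS]hT mxE.
Qed.

Lemma christoffel_metric m (h : 'rV[R]_m -> 'M[R]_m) k i j x :
  (forall z, (h z)^T = h z) -> h x \in unitmx ->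
  partial k (fun z => h z i j) x =
    \sum_l (christoffel h l k i x * h x l j + christoffel h l k j x * h x i l).
Proof.
move=> hT hU.
have hS a b z : h z a b = h z b a by rewrite -[in LHS]hT mxE.
have pS a b c : partial c (fun z => h z a b) x = partial c (fun z => h z b a) x.
  by congr (partial c _ x); apply/funext => z.
have low a b c : \sum_l christoffel h l a b x * h x l c
    = 2^-1 * (partial a (fun z => h z b c) x + partial b (fun z => h z a c) x
              - partial c (fun z => h z a b) x).
  pose D := \col_l (partial a (fun z => h z b l) x
    + partial b (fun z => h z a l) x - partial l (fun z => h z a b) x).
  transitivity (2^-1 * (h x *m (invmx (h x) *m D)) c 0).
    rewrite mxE big_distrr /=; apply: eq_bigr => l _; rewrite /christoffel mxE.
    rewrite (hS l c) -mulrA; congr (_ * _); rewrite mulrC; congr (_ * _).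
    by apply: eq_bigr => p _; rewrite mxE.
  by rewrite mulKVmx // mxE.
rewrite big_split /= low.
under [X in _ = _ + X]eq_bigr => l _ do rewrite (hS i l).
by rewrite low (pS j i); field.
Qed.

(* Gamma_x(X, Y), so that nabla_X Y = D_X Y + Gamma_x(X, Y). *)
Definition connection_form m (h : 'rV[R]_m -> 'M[R]_m) (x X Y : 'rV[R]_m) :
    'rV[R]_m :=
  \row_k \sum_i \sum_j christoffel h k i j x * X 0 i * Y 0 j.

Definition partial_row m q (i : 'I_m) (f : 'rV[R]_m -> 'rV[R]_q)
    (x : 'rV[R]_m) : 'rV[R]_q :=
  \row_a partial i (fun z => f z 0 a) x.

(* (nabla df)(d_i, d_j), for a map f from (R^m, g) to (R^q, h). *)
Definition nabla_d m q (g : 'rV[R]_m -> 'M[R]_m) (h : 'rV[R]_q -> 'M[R]_q)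
    (f : 'rV[R]_m -> 'rV[R]_q) (i j : 'I_m) (x : 'rV[R]_m) : 'rV[R]_q :=
  partial_row i (partial_row j f) x
  + connection_form h (f x) (partial_row i f x) (partial_row j f x)
  - \sum_k christoffel g k i j x *: partial_row k f x.

Definition tension m q (g : 'rV[R]_m -> 'M[R]_m) (h : 'rV[R]_q -> 'M[R]_q)
    (f : 'rV[R]_m -> 'rV[R]_q) (x : 'rV[R]_m) : 'rV[R]_q :=
  \sum_i \sum_j invmx (g x) i j *: nabla_d g h f i j x.

(* In the chart of the tangent bundle induced by a chart of the base, the
   point row_mx x u stands for the tangent vector of components u at x.  Tangent
   vectors X, and lifts, are given by their components as well. *)
Definition hlift m (g : 'rV[R]_m -> 'M[R]_m) (z : 'rV[R]_(m + m))
    (X : 'rV[R]_m) : 'rV[R]_(m + m) :=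
  row_mx X (- connection_form g (lsubmx z) X (rsubmx z)).

Definition vlift m (X : 'rV[R]_m) : 'rV[R]_(m + m) := row_mx 0 X.

Definition kaluza_klein_eqs m (g : 'rV[R]_m -> 'M[R]_m) (A B C : R -> R)
    (G : 'rV[R]_(m + m) -> 'M[R]_(m + m)) : Prop :=
  forall (z : 'rV[R]_(m + m)) (X Y : 'rV[R]_m),
    let gp := form (g (lsubmx z)) in
    let e := rsubmx z in
    [/\ form (G z) (hlift g z X) (hlift g z Y) = A (gp e e) * gp X Y,
        form (G z) (hlift g z X) (vlift Y) = 0
      & form (G z) (vlift X) (vlift Y)
        = B (gp e e) * gp X Y + C (gp e e) * gp X e * gp Y e].

(* f1 is the derivative of f on [0, +oo[, one-sided at 0. *)
Definition derivative_ge0 (f f1 : R -> R) : Prop :=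
  forall t : R, 0 <= t ->
    (fun s : R => (f s - f t) / (s - t)) @ within [set s | 0 <= s] t^'
      --> (f1 t : R^o).

Definition C2_ge0 (f : R -> R) : Prop :=
  exists f1 f2 : R -> R,
    [/\ derivative_ge0 f f1, derivative_ge0 f1 f2
      & {within [set s : R | 0 <= s], continuous (f2 : R -> R^o)}].

End Coordinates.

Section Sphere.
Context {R : realType}.

Definition dot m (u v : 'rV[R]_m) : R := (u *m v^T) 0 0.

Lemma dotZZ m a b (u v : 'rV[R]_m) : dot (a *: u) (b *: v) = a * b * dot u v.
Proof. by rewrite /dot linearZ /= -scalemxAl -scalemxAr scalerA mxE. Qed.

Lemma dot_row_mx m q (u u' : 'rV[R]_m) (v v' : 'rV[R]_q) :
  dot (row_mx u v) (row_mx u' v') = dot u u' + dot v v'.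
Proof. by rewrite /dot tr_row_mx mul_row_col mxE. Qed.

Lemma dot_scalar (a b : R) : dot (a%:M : 'rV_1) b%:M = a * b.
Proof. by rewrite /dot tr_scalar_mx -scalar_mxM mxE eqxx mulr1n. Qed.

Lemma dot_ge0 m (u : 'rV[R]_m) : 0 <= dot u u.
Proof.
by rewrite /dot mxE sumr_ge0 // => i _; rewrite mxE -expr2 sqr_ge0.
Qed.

Definition on_sphere n (x : 'rV[R]_(1 + n)) : Prop := dot x x = 1.

(* Inverse of the stereographic projection from the pole ((-1)^s, 0). *)
Definition stereo n (s : bool) (y : 'rV[R]_n) : 'rV[R]_(1 + n) :=
  (1 + dot y y)^-1 *: row_mx ((-1) ^+ s * (dot y y - 1))%:M (2 *: y).

Lemma stereo_on_sphere n s (y : 'rV[R]_n) : on_sphere (stereo s y).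
Proof.
have d1 : 1 + dot y y != 0 by rewrite gt_eqF// ltr_wpDr// dot_ge0.
rewrite /on_sphere /stereo dotZZ dot_row_mx dot_scalar dotZZ.
by case: s; rewrite ?expr0 ?expr1; field.
Qed.

Lemma stereo_surj n (x : 'rV[R]_(1 + n)) :
  on_sphere x -> exists s y, x = stereo s y.
Proof.
rewrite /on_sphere -(hsubmxK x) (mx11_scalar (lsubmx x)).
set a := lsubmx x 0 0; set v := rsubmx x.
rewrite dot_row_mx dot_scalar => H.
have vv : dot v v = 1 - a * a by rewrite -H; ring.
exists (0 < a); exists ((1 + `|a|)^-1 *: v).
have b0 : 1 + `|a| != 0 by rewrite gt_eqF// ltr_wpDr.
rewrite /stereo dotZZ vv.
have [a0|a0] := ltP 0 a.
  rewrite gtr0_norm // in b0 *.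
  have E : 1 + (1 + a)^-1 * (1 + a)^-1 * (1 - a * a) = 2 * (1 + a)^-1 by field.
  have F : (1 + a)^-1 * (1 + a)^-1 * (1 - a * a) - 1 = - 2 * a * (1 + a)^-1.
    by field.
  rewrite E F scale_row_mx !scalerA scale_scalar_mx expr1; congr row_mx.
    by congr (_%:M); field.
  by rewrite -[LHS]scale1r; congr (_ *: _); field.
rewrite ler0_norm // in b0 *.
have E : 1 + (1 - a)^-1 * (1 - a)^-1 * (1 - a * a) = 2 * (1 - a)^-1 by field.
have F : (1 - a)^-1 * (1 - a)^-1 * (1 - a * a) - 1 = 2 * a * (1 - a)^-1.
  by field.
rewrite E F scale_row_mx !scalerA scale_scalar_mx expr0; congr row_mx.
  by congr (_%:M); field.
by rewrite -[LHS]scale1r; congr (_ *: _); field.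
Qed.

(* The canonical metric of S^n, read in the chart. *)
Definition sphere_metric n (s : bool) (y : 'rV[R]_n) : 'M[R]_n :=
  \matrix_(i, j) dot (partial_row i (stereo s) y) (partial_row j (stereo s) y).

(* A vector field on S^n is a map xi on the ambient space, of which only the
   values on S^n matter, and these are tangent to S^n. *)
Definition tangent_field n (xi : 'rV[R]_(1 + n) -> 'rV[R]_(1 + n)) : Prop :=
  forall x, on_sphere x -> dot (xi x) x = 0.

(* The components of xi: for a tangent field, the only v such that
   \sum_i v_i d_i(stereo s) = xi \o stereo s. *)
Definition components n (xi : 'rV[R]_(1 + n) -> 'rV[R]_(1 + n)) (s : bool)
    (y : 'rV[R]_n) : 'rV[R]_n :=
  (\row_j dot (xi (stereo s y)) (partial_row j (stereo s) y))
    *m invmx (sphere_metric s y).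

Definition smooth_field n (xi : 'rV[R]_(1 + n) -> 'rV[R]_(1 + n)) : Prop :=
  forall s i, smooth (fun y => components xi s y 0 i).

(* The Lie derivative of the metric along xi vanishes. *)
Definition killing n (xi : 'rV[R]_(1 + n) -> 'rV[R]_(1 + n)) : Prop :=
  forall s y i j,
    let g := sphere_metric s in
    let v := components xi s in
    \sum_k (v y 0 k * partial k (fun z => g z i j) y
            + g y k j * partial i (fun z => v z 0 k) y
            + g y i k * partial j (fun z => v z 0 k) y) = 0.

Definition killing_field n (xi : 'rV[R]_(1 + n) -> 'rV[R]_(1 + n)) : Prop :=
  [/\ tangent_field xi, smooth_field xi & killing xi].

Definition nonzero_field n (xi : 'rV[R]_(1 + n) -> 'rV[R]_(1 + n)) : Prop :=
  exists2 x, on_sphere x & xi x != 0.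

Definition constant_norm n (xi : 'rV[R]_(1 + n) -> 'rV[R]_(1 + n)) : Prop :=
  exists c : R, forall x, on_sphere x -> Num.sqrt (dot (xi x) (xi x)) = c.

(* G s is the expression of the metric in the induced chart s of T S^n.  The
   equations determine it from A, B and C, hence the two expressions agree on
   the overlap of the charts. *)
Definition kaluza_klein_metric n (A B C : R -> R)
    (G : bool -> 'rV[R]_(n + n) -> 'M[R]_(n + n)) : Prop :=
  [/\ [/\ C2_ge0 A, C2_ge0 B & C2_ge0 C],
      forall t, 0 <= t -> 0 < A t,
      forall s, riemannian (G s)
    & forall s, kaluza_klein_eqs (sphere_metric s) A B C (G s)].

(* The map p |-> (p, xi p) from S^n to T S^n. *)
Definition section_map n (xi : 'rV[R]_(1 + n) -> 'rV[R]_(1 + n)) (s : bool)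
    (y : 'rV[R]_n) : 'rV[R]_(n + n) :=
  row_mx y (components xi s y).

Definition tau n (G : bool -> 'rV[R]_(n + n) -> 'M[R]_(n + n))
    (xi : 'rV[R]_(1 + n) -> 'rV[R]_(1 + n)) (s : bool) (y : 'rV[R]_n) :
    'rV[R]_(n + n) :=
  tension (sphere_metric s) (G s) (section_map xi s) y.

Definition tau_h n (G : bool -> 'rV[R]_(n + n) -> 'M[R]_(n + n))
    (xi : 'rV[R]_(1 + n) -> 'rV[R]_(1 + n)) (s : bool) (y : 'rV[R]_n) :
    'rV[R]_n :=
  lsubmx (tau G xi s y).

Definition tau_v n (G : bool -> 'rV[R]_(n + n) -> 'M[R]_(n + n))
    (xi : 'rV[R]_(1 + n) -> 'rV[R]_(1 + n)) (s : bool) (y : 'rV[R]_n) :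
    'rV[R]_n :=
  rsubmx (tau G xi s y)
  + connection_form (sphere_metric s) y (tau_h G xi s y) (components xi s y).

Lemma tau_decomposition n (G : bool -> 'rV[R]_(n + n) -> 'M[R]_(n + n)) xi s y :
  tau G xi s y =
    hlift (sphere_metric s) (section_map xi s y) (tau_h G xi s y)
    + vlift (tau_v G xi s y).
Proof.
rewrite /hlift /vlift /section_map row_mxKl row_mxKr add_row_mx addr0.
by rewrite addrC addrK hsubmxK.
Qed.

Definition harmonic_map n (G : bool -> 'rV[R]_(n + n) -> 'M[R]_(n + n))
    (xi : 'rV[R]_(1 + n) -> 'rV[R]_(1 + n)) : Prop :=
  forall s y, tau G xi s y = 0.

Definition harmonic_section n (G : bool -> 'rV[R]_(n + n) -> 'M[R]_(n + n))
    (xi : 'rV[R]_(1 + n) -> 'rV[R]_(1 + n)) : Prop :=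
  forall s y, tau_v G xi s y = 0.

End Sphere.

(* Main.v *)
(* On the sphere take the Kaluza-Klein metric with B = 1, C = 0 and A(t) affine
   of slope -(n-1)/n on the range of t = |xi|^2, which is bounded; a cubic term
   added beyond that range keeps A positive.  For a Killing field the trace of
   the second covariant derivative is -(n-1) xi and the covariant derivative is
   skew, so that
     tau^v = - (n A' + n - 1) xi   and   A tau^h = (2 A' + 1) grad (t / 2).
   Hence tau^v = 0, and 2 A' + 1 = (2 - n)/n: xi is a harmonic map when n = 2,
   and for n > 2 only when its norm is constant.  If the norm is a non-zero
   constant and n is even, the covariant derivative of xi at a point and xi form
   a skew matrix of odd size n + 1; a vector in its kernel is orthogonal to xi
   and annihilated by the covariant derivative, which contradicts the vanishing
   of the Hessian of t.  The computations are made in a stereographic chart,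
   where the metric is conformal to the Euclidean one. *)
From HB Require Import structures.
From mathcomp Require Import all_boot all_order all_algebra.
From mathcomp Require Import all_classical all_reals.
From mathcomp Require Import topology normedtype derive realfun.
From mathcomp Require Import ring lra.
Require Import Defs.

Set Implicit Arguments.
Unset Strict Implicit.
Unset Printing Implicit Defensive.

Import Order.TTheory GRing.Theory Num.Theory.
Import numFieldNormedType.Exports.

Local Open Scope classical_set_scope.
Local Open Scope ring_scope.

(** * Dot product and differentials *)

Section DotAlgebra.
Context {R : realType} {m : nat}.
Implicit Types u v w : 'rV[R]_m.

Lemma dotE u v : dot u v = \sum_i u 0 i * v 0 i.
Proof. by rewrite /dot mxE; apply: eq_bigr => i _; rewrite mxE. Qed.

Lemma dotC u v : dot u v = dot v u.
Proof. by rewrite !dotE; apply: eq_bigr => i _; rewrite mulrC. Qed.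

Lemma dotDl u v w : dot (u + v) w = dot u w + dot v w.
Proof. by rewrite /dot mulmxDl mxE. Qed.

Lemma dotNl u w : dot (- u) w = - dot u w.
Proof. by rewrite /dot mulNmx mxE. Qed.

Lemma dotZl a u w : dot (a *: u) w = a * dot u w.
Proof. by rewrite /dot -scalemxAl mxE. Qed.

Lemma dotDr u v w : dot w (u + v) = dot w u + dot w v.
Proof. by rewrite dotC dotDl !(dotC w). Qed.

Lemma dotNr u w : dot w (- u) = - dot w u.
Proof. by rewrite dotC dotNl dotC. Qed.

Lemma dotZr a u w : dot w (a *: u) = a * dot w u.
Proof. by rewrite dotC dotZl dotC. Qed.

Lemma dot0l u : dot 0 u = 0. Proof. by rewrite /dot mul0mx mxE. Qed.
Lemma dot0r u : dot u 0 = 0. Proof. by rewrite dotC dot0l. Qed.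

Lemma dot_suml (I : finType) (F : I -> 'rV[R]_m) u :
  dot (\sum_i F i) u = \sum_i dot (F i) u.
Proof. by rewrite /dot mulmx_suml summxE. Qed.

Definition dot_lin := (dotDl, dotDr, dotNl, dotNr, dotZl, dotZr, dot0l, dot0r).

Lemma dot_delta i u : dot (delta_mx 0 i) u = u 0 i.
Proof. by rewrite /dot -rowE !mxE. Qed.

Lemma dot_deltar i u : dot u (delta_mx 0 i) = u 0 i.
Proof. by rewrite dotC dot_delta. Qed.

Lemma dot_eq0 u : (dot u u == 0) = (u == 0).
Proof.
apply/eqP/eqP => [|->]; last exact: dot0l.
rewrite dotE => /eqP; rewrite psumr_eq0; last by move=> i _; rewrite -expr2 sqr_ge0.
move=> /allP H; apply/rowP => i; have := H i (mem_index_enum _).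
by rewrite /= mulf_eq0 orbb mxE => /eqP.
Qed.

Lemma dot_gt0 u : u != 0 -> 0 < dot u u.
Proof. by move=> u0; rewrite lt_def dot_eq0 u0 dot_ge0. Qed.

Lemma dot_inj u v : (forall w, dot u w = dot v w) -> u = v.
Proof. by move=> H; apply/rowP => i; rewrite -!dot_deltar. Qed.

Lemma dot_mulmx p (u : 'rV[R]_p) (M : 'M[R]_(p, m)) v :
  dot (u *m M) v = dot u (v *m M^T).
Proof. by rewrite /dot trmx_mul trmxK mulmxA. Qed.

End DotAlgebra.

Lemma form_scalar (R : realType) m (a : R) (u v : 'rV[R]_m) :
  form a%:M u v = a * dot u v.
Proof. by rewrite /form mul_mx_scalar -scalemxAl mxE. Qed.

(* [is_diff] itself is a class, whose instance search diverges when the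
   differential is an evar. *)
Definition has_diff (R : realType) (V W : normedModType R) (x : V) (f df : V -> W) :
  Prop := is_diff x f df.

(** * Rules of calculus for differentials *)

Section DiffRules.
Context {R : realType} {V : normedModType R}.
Implicit Types (x h : V).

Lemma has_diff_ext (W : normedModType R) (f g df dg : V -> W) x :
  has_diff x f df -> f =1 g -> df =1 dg -> has_diff x g dg.
Proof. by move=> H /funext <- /funext <-. Qed.

Lemma has_diff_add (W : normedModType R) (f g df dg : V -> W) x :
  has_diff x f df -> has_diff x g dg ->
  has_diff x (fun z => f z + g z) (fun h => df h + dg h).
Proof. exact: is_diffD. Qed.

Lemma has_diff_opp (W : normedModType R) (f df : V -> W) x :
  has_diff x f df -> has_diff x (fun z => - f z) (fun h => - df h).
Proof. exact: is_diffN. Qed.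

Lemma has_diff_const (W : normedModType R) (a : W) x :
  has_diff x (fun=> a) (fun=> 0).
Proof. exact: is_diff_cst. Qed.

Lemma has_diff_mul (f g df dg : V -> R^o) x :
  has_diff x f df -> has_diff x g dg ->
  has_diff x (fun z => f z * g z : R^o) (fun h => df h * g x + f x * dg h).
Proof.
move=> H1 H2; apply: (has_diff_ext (@is_diffM R V f g df dg x H1 H2)) => // h.
by rewrite [RHS]addrC [_ * g x]mulrC.
Qed.

Lemma has_diff_inv (f df : V -> R^o) x : has_diff x f df -> f x != 0 ->
  has_diff x (fun z => (f z)^-1 : R^o) (fun h => - (f x) ^- 2 * df h).
Proof.
move=> [H1 H2] f0; split; first exact: differentiableV.
by rewrite diffV // H2.
Qed.

Lemma has_diff_sum m (W : normedModType R) (f df : 'I_m -> V -> W) x :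
  (forall i, has_diff x (f i) (df i)) ->
  has_diff x (fun z => \sum_i f i z) (fun h => \sum_i df i h).
Proof.
move=> H.
have E (F : 'I_m -> V -> W) (r : seq 'I_m) : (fun z => \sum_(i <- r) F i z) = \sum_(i <- r) F i.
  by apply/funext => z; elim/big_rec2 : _ => // i y1 y2 _ ->.
rewrite !E; elim/big_rec2 : _ => [|i f1 f2 _ IH]; first exact: is_diff_cst.
exact: (@is_diffD _ _ _ _ _ _ _ _ (H i) IH).
Qed.

Lemma has_diff_lin (W : normedModType R) (f : {linear V -> W}) x :
  continuous f -> has_diff x f f.
Proof. by move=> fc; split; [exact: linear_differentiable|exact: diff_lin]. Qed.

Lemma has_diffE (W : normedModType R) (f df : V -> W) x h :
  has_diff x f df -> 'D_h f x = df h.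
Proof. by move=> [d <-]; rewrite deriveE. Qed.

Lemma has_diff_scale (W : normedModType R) (k dk : V -> R^o) (w : W) x :
  has_diff x k dk -> has_diff x (fun z => k z *: w) (fun h => dk h *: w).
Proof.
by move=> [d <-]; split; [exact: differentiableZl|rewrite diffZl].
Qed.

Lemma has_diff_row m (f df : V -> 'rV[R]_m) x :
  (forall i, has_diff x (fun z => f z 0 i : R^o) (fun h => df h 0 i)) ->
  has_diff x f df.
Proof.
move=> H; have {H} := has_diff_sum (fun i => has_diff_scale (delta_mx 0 i : 'rV_m) (H i)).
move=> S; apply: (has_diff_ext S) => z; by rewrite -row_sum_delta.
Qed.

End DiffRules.

Section DiffRow.
Context {R : realType}.

Lemma has_diff_comp_fun (U V W : normedModType R) (f df : U -> V) (g dg : V -> W) x :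
  has_diff x f df -> has_diff (f x) g dg ->
  has_diff x (fun z => g (f z)) (fun h => dg (df h)).
Proof. exact: is_diff_comp. Qed.

Lemma has_diff_entry m q i j (M : 'M[R]_(m, q)) :
  has_diff M (fun N : 'M[R]_(m, q) => N i j : R^o) (fun N => N i j).
Proof.
have lin : linear (fun N : 'M[R]_(m, q) => N i j : R^o) by move=> a u v; rewrite !mxE.
pose lM := GRing.isLinear.Build _ _ _ _ _ lin.
pose f : {linear _ -> _} := HB.pack (fun N : 'M[R]_(m, q) => N i j : R^o) lM.
exact: (@has_diff_lin _ _ _ f _ (@coord_continuous _ _ _ _ _)).
Qed.

Lemma has_diff_lsub m q (z : 'rV[R]_(m + q)) : has_diff z lsubmx lsubmx.
Proof.
by split; [exact: differentiable_lsubmx|exact/diff_lin/continuous_lsubmx].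
Qed.

Lemma has_diff_rsub m q (z : 'rV[R]_(m + q)) : has_diff z rsubmx rsubmx.
Proof.
by split; [exact: differentiable_rsubmx|exact/diff_lin/continuous_rsubmx].
Qed.

Context {V : normedModType R}.

Lemma has_diff_coord m (f df : V -> 'rV[R]_m) x i :
  has_diff x f df -> has_diff x (fun z => f z 0 i : R^o) (fun h => df h 0 i).
Proof. by move=> H; exact: (has_diff_comp_fun H (has_diff_entry _ _ _)). Qed.

Lemma has_diff_dot m (f g df dg : V -> 'rV[R]_m) x :
  has_diff x f df -> has_diff x g dg ->
  has_diff x (fun z => dot (f z) (g z) : R^o)
    (fun h => dot (df h) (g x) + dot (f x) (dg h)).
Proof.
move=> Hf Hg.
have := has_diff_sum (fun i => has_diff_mul (has_diff_coord i Hf) (has_diff_coord i Hg)).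
by move/has_diff_ext; apply=> z; rewrite ?big_split !dotE.
Qed.

Lemma has_diff_scalev m (k dk : V -> R^o) (f df : V -> 'rV[R]_m) x :
  has_diff x k dk -> has_diff x f df ->
  has_diff x (fun z => k z *: f z) (fun h => dk h *: f x + k x *: df h).
Proof.
move=> Hk Hf; apply: has_diff_row => i.
have /has_diff_ext := has_diff_mul Hk (has_diff_coord i Hf).
by apply=> z; rewrite !mxE.
Qed.

Lemma has_diff_row_mx m q (f df : V -> 'rV[R]_m) (g dg : V -> 'rV[R]_q) x :
  has_diff x f df -> has_diff x g dg ->
  has_diff x (fun z => row_mx (f z) (g z)) (fun h => row_mx (df h) (dg h)).
Proof.
move=> Hf Hg; apply: has_diff_row => i; case: (split_ordP i) => j ->.
- by have /has_diff_ext := has_diff_coord j Hf; apply=> z; rewrite row_mxEl.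
- by have /has_diff_ext := has_diff_coord j Hg; apply=> z; rewrite row_mxEr.
Qed.

End DiffRow.

Lemma partial_row_diff (R : realType) m q (f df : 'rV[R]_m -> 'rV[R]_q) x i :
  has_diff x f df -> partial_row i f x = df (delta_mx 0 i).
Proof.
move=> H; apply/rowP => a; rewrite mxE /partial.
exact: has_diffE (has_diff_coord a H).
Qed.

Lemma partial_diff (R : realType) m (f df : 'rV[R]_m -> R^o) x i :
  has_diff x f df -> partial i f x = df (delta_mx 0 i).
Proof. exact: has_diffE. Qed.

(** * Symmetry of second derivatives *)

Section Schwarz.
Context {R : realType}.

Lemma has_diff_derive (V W : normedModType R) (f : V -> W) x :
  differentiable f x -> has_diff x f (fun h => 'D_h f x).
Proof. by move=> d; split=> //; apply/funext => h; rewrite deriveE. Qed.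

Lemma is_derive_line (V : normedModType R) (f df : V -> R^o) (x a : V) (t : R) :
  has_diff (x + t *: a) f df ->
  is_derive t 1 (fun u : R => f (x + u *: a) : R^o) (df a).
Proof.
move=> H.
have line : has_diff t (fun u : R^o => x + u *: a) (fun u : R^o => u *: a).
  have /has_diff_ext := has_diff_add (has_diff_const x t)
     (has_diff_scale a (is_diff_id (t : R^o))).
  by apply=> // h; rewrite add0r.
have [d E] := has_diff_comp_fun line H.
split; first exact: diff_derivable.
by rewrite deriveE // E scale1r.
Qed.

Lemma mean_value_line (V : normedModType R) (f : V -> R^o) (x a : V) (h : R) :
  0 < h -> (forall z, differentiable f z) ->
  exists2 t, 0 <= t <= h & f (x + h *: a) - f x = h * 'D_a f (x + t *: a).
Proof.
move=> h0 df.
have D t : is_derive (t : R^o) 1 (fun u : R => f (x + u *: a) : R^o) ('D_a f (x + t *: a)).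
  exact: (is_derive_line (has_diff_derive _)).
have [|t tI E] := MVT h0 (fun t _ => D t).
  by apply: derivable_within_continuous => t _; have [] := D t.
exists t; first by move: tI; rewrite in_itv /= => /andP[/ltW -> /ltW ->].
by move: E; rewrite scale0r addr0 subr0 => ->; rewrite mulrC.
Qed.

(** The mean value theorem is used twice: along [a] for the increment of [f] in direction [h *: b],
    then along [b] for ['D_a f]. *)
Lemma second_difference (V : normedModType R) (f : V -> R^o) (x a b : V) (h : R) :
  0 < h -> (forall z, differentiable f z) ->
  (forall z, differentiable ('D_a f : V -> R^o) z) ->
  exists p : R * R, [/\ 0 <= p.1 <= h, 0 <= p.2 <= h &
    f (x + h *: a + h *: b) - f (x + h *: a) - f (x + h *: b) + f x =
    h * h * 'D_b ('D_a f : V -> R^o) (x + p.1 *: a + p.2 *: b)].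
Proof.
move=> h0 df df'.
pose g z : R^o := f (z + h *: b) - f z.
have dg z : has_diff z g (fun k => 'D_k f (z + h *: b) - 'D_k f z).
  apply: has_diff_add; last exact: has_diff_opp (has_diff_derive _).
  have sh : has_diff z (fun u => u + h *: b) id.
    have /has_diff_ext := has_diff_add (is_diff_id z) (has_diff_const (h *: b) z).
    by apply=> // k; rewrite addr0.
  exact: (has_diff_comp_fun sh (has_diff_derive _)).
have [|t tI Et] := @mean_value_line _ g x a h h0; first by move=> z; have [] := dg z.
have [s sI Es] := @mean_value_line _ ('D_a f : V -> R^o) (x + t *: a) b h h0 df'.
exists (t, s); split => //=.
move: Et; rewrite (has_diffE _ (dg _)) Es /g -mulrA => <-; ring.
Qed.

(** The points [y] and [z] may differ, as do the intermediate points of two mean value theorems;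
    continuity at [x] absorbs the gap. *)
Lemma eq_at_limit (V : normedModType R) (F G : V -> R^o) (x : V) :
  {for x, continuous F} -> {for x, continuous G} ->
  (forall r, 0 < r -> exists y z, [/\ `|x - y| < r, `|x - z| < r & F y = G z]) ->
  F x = G x.
Proof.
move=> cF cG FG; apply/eqP; rewrite -subr_eq0 -normr_le0.
apply/ler_addgt0Pl => e e0; rewrite addr0.
have e2 : 0 < e / 2 by rewrite divr_gt0.
move/cvgrPdist_lt : cF => /(_ _ e2) /nbhs_ballP[r /= r0 Hr].
move/cvgrPdist_lt : cG => /(_ _ e2) /nbhs_ballP[q /= q0 Hq].
have [|y [z [xy xz E]]] := FG (Num.min r q); first by rewrite lt_min r0.
have {}Hr : `|F x - F y| < e / 2.
  by apply: (Hr y); rewrite -ball_normE /= (lt_le_trans xy) // ge_min lexx.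
have {}Hq : `|G x - G z| < e / 2.
  by apply: (Hq z); rewrite -ball_normE /= (lt_le_trans xz) // ge_min lexx orbT.
rewrite -(subrKA (F y)) {2}E (le_trans (ler_normD _ _)) // [leRHS](splitr e).
by rewrite lerD ?ltW // distrC.
Qed.

(** Schwarz's theorem: the second difference is symmetric in [a] and [b], so the two mixed
    derivatives take equal values at two points of a parallelogram that shrinks to [x]. *)
Lemma derive_comm (V : normedModType R) (f : V -> R^o) (x a b : V) :
  (forall z, differentiable f z) ->
  (forall z, differentiable ('D_a f : V -> R^o) z) ->
  (forall z, differentiable ('D_b f : V -> R^o) z) ->
  {for x, continuous ('D_b ('D_a f : V -> R^o) : V -> R^o)} ->
  {for x, continuous ('D_a ('D_b f : V -> R^o) : V -> R^o)} ->
  'D_b ('D_a f : V -> R^o) x = 'D_a ('D_b f : V -> R^o) x.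
Proof.
move=> df da db cab cba; apply: (eq_at_limit cab cba) => r r0.
(* With [h = r / (2 N)] every point of the parallelogram is within [h * N = r / 2] of [x]; the added
   1 makes [N] positive even when [a] and [b] vanish. *)
pose N := `|a| + `|b| + 1.
have N0 : 0 < N by rewrite ltr_wpDl // addr_ge0.
pose h := r / 2 / N.
have h0 : 0 < h by rewrite !divr_gt0.
have near_x (c d : V) (p : R * R) : `|c| + `|d| + 1 = N -> 0 <= p.1 <= h -> 0 <= p.2 <= h ->
    `|x - (x + p.1 *: c + p.2 *: d)| < r.
  move=> EN /andP[p10 p1h] /andP[p20 p2h].
  rewrite -addrA opprD addrA subrr add0r normrN (le_lt_trans (ler_normD _ _)) //.
  rewrite !normrZ !ger0_norm //.
  apply: (@le_lt_trans _ _ (h * N)).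
    rewrite -EN !mulrDr mulr1 -[leLHS]addr0 lerD //; last exact: ltW.
    by rewrite lerD // ler_wpM2r.
  by rewrite /h divfK ?gt_eqF // ltr_pdivrMr // ltr_pMr // ltr1n.
have [p [p1 p2 Ep]] := second_difference x b h0 df da.
have [p' [p1' p2' Ep']] := second_difference x a h0 df db.
exists (x + p.1 *: a + p.2 *: b), (x + p'.1 *: b + p'.2 *: a); split.
- exact: near_x.
- by apply: near_x => //; rewrite [`|b| + _]addrC.
- have cancel (u w k l c d : R) :
      k - l - c + d = h * h * u -> k - c - l + d = h * h * w -> u = w.
    move=> Eu Ew; have hh : h * h != 0 by rewrite mulf_neq0 // gt_eqF.
    by apply: (mulfI hh); rewrite -Eu -Ew; congr (_ + _); rewrite addrAC.
  move: Ep'; rewrite (addrAC x (h *: b)); exact: cancel Ep.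
Qed.

End Schwarz.

Lemma is_Ck_differentiable (R : realType) m k (f : 'rV[R]_m -> R^o) x :
  is_Ck k.+1 f -> differentiable f x.
Proof. by case. Qed.

Lemma partial_comm (R : realType) m (f : 'rV[R]_m -> R^o) i j x :
  is_Ck 2 f ->
  partial i (partial j f) x = partial j (partial i f) x.
Proof.
move=> [df Cf].
have dp l z : differentiable (partial l f : _ -> R^o) z by have [d _] := Cf l; exact: d.
have cp l q : {for x, continuous (partial l (partial q f) : _ -> R^o)}.
  by have [_ c] := Cf q; exact: c.
by apply: derive_comm => //; [exact: dp|exact: dp|exact: cp|exact: cp].
Qed.

(** * The Levi-Civita connection in coordinates *)

Section Connection.
Context {R : realType} {m : nat}.
Implicit Types (x X Y W : 'rV[R]_m) (h : 'rV[R]_m -> 'M[R]_m).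

Lemma derive_partial (f : 'rV[R]_m -> R^o) x X :
  differentiable f x -> 'D_X f x = \sum_i X 0 i * partial i f x.
Proof.
move=> d; rewrite deriveE // {1}(row_sum_delta X) linear_sum.
by apply: eq_bigr => i _; rewrite linearZ /= /partial deriveE.
Qed.

Lemma formE (S : 'M[R]_m) X Y : form S X Y = \sum_i \sum_j X 0 i * Y 0 j * S i j.
Proof.
rewrite -[LHS]/(dot (X *m S) Y) dot_mulmx dotE; apply: eq_bigr => i _.
rewrite mxE big_distrr; apply: eq_bigr => j _ /=; rewrite mxE; ring.
Qed.

Lemma derive_form h x X Y W :
  (forall a b, differentiable (fun z => h z a b : R^o) x) ->
  'D_X (fun z => form (h z) Y W : R^o) x =
  \sum_i \sum_j \sum_l X 0 i * Y 0 j * W 0 l * partial i (fun z => h z j l) x.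
Proof.
move=> d.
have E : has_diff x (fun z => form (h z) Y W : R^o)
    (fun X => \sum_j \sum_l Y 0 j * W 0 l * 'D_X (fun z => h z j l : R^o) x).
  have /has_diff_ext := has_diff_sum (fun j => has_diff_sum (fun l =>
    has_diff_mul (has_diff_const (Y 0 j * W 0 l : R^o) x) (has_diff_derive (d j l)))).
  apply=> z; first by rewrite formE.
  by apply: eq_bigr => j _; apply: eq_bigr => l _; rewrite mul0r add0r.
rewrite (has_diffE X E) [RHS]exchange_big /=; apply: eq_bigr => j _.
rewrite [RHS]exchange_big /=; apply: eq_bigr => l _.
rewrite derive_partial // big_distrr /=; apply: eq_bigr => i _. ring.
Qed.

(** Koszul's formula for fields with constant components, whose brackets vanish. Pairing with [W]
    removes the inverse matrix from the Christoffel symbols. *)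
Lemma form_connection h x X Y W :
  (forall z, (h z)^T = h z) -> h x \in unitmx ->
  (forall a b, differentiable (fun z => h z a b : R^o) x) ->
  form (h x) (connection_form h x X Y) W =
  2^-1 * ('D_X (fun z => form (h z) Y W : R^o) x
          + 'D_Y (fun z => form (h z) X W : R^o) x
          - 'D_W (fun z => form (h z) X Y : R^o) x).
Proof.
move=> hT hU d.
pose D i j l := partial i (fun z => h z j l) x + partial j (fun z => h z i l) x
     - partial l (fun z => h z i j) x.
pose w := \row_l \sum_i \sum_j X 0 i * Y 0 j * D i j l.
have -> : connection_form h x X Y = 2^-1 *: (w *m invmx (h x)).
  apply/rowP => k; rewrite !mxE big_distrr /=.
  under [LHS]eq_bigr => i _ do (under eq_bigr => j _ do
    rewrite /christoffel -!mulrA mulr_suml mulr_sumr).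
  under [LHS]eq_bigr => i _ do rewrite exchange_big.
  rewrite exchange_big /=; apply: eq_bigr => l _.
  rewrite mxE mulr_suml mulr_sumr; apply: eq_bigr => i _.
  rewrite mulr_suml mulr_sumr; apply: eq_bigr => j _.
  have -> : invmx (h x) k l = invmx (h x) l k by rewrite -[in LHS](hT x) -trmx_inv mxE.
  rewrite /D; ring.
rewrite /form -scalemxAl -scalemxAl mulmxKV // mxE; congr (_ * _).
rewrite -/(dot w W) dotE !derive_form //.
rewrite [X in _ + X - _]exchange_big /=.
rewrite [X in _ - X]exchange_big /=.
under [X in _ - X]eq_bigr => i _ do rewrite exchange_big.
under [LHS]eq_bigr => l _ do rewrite mxE mulr_suml.
rewrite exchange_big /= -big_split -sumrB /=; apply: eq_bigr => i _.
under eq_bigr => l _ do rewrite mulr_suml.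
rewrite exchange_big /= -big_split -sumrB /=; apply: eq_bigr => j _.
rewrite -big_split -sumrB /=; apply: eq_bigr => l _; rewrite /D; ring.
Qed.
End Connection.

(** * The stereographic charts *)

(* The Levi-Civita connection of a metric conformal to [b], with [p] the
   gradient of the logarithm of the conformal factor.  The form [b] is abstract
   so that polynomial identities are not checked by unfolding matrices. *)
Definition lc_form (R : realType) (V : lmodType R) (b : V -> V -> R) (p X u : V) : V :=
  b p u *: X + b p X *: u - b X u *: p.

Notation Gam := (lc_form (@dot _ _)).

(* The chart metric is [conf y ^+ 2] times the Euclidean one, and [psi] is the
   gradient of [ln conf]. *)
Section StereographicChart.
Context {R : realType} {n : nat}.
Implicit Types (y h X u W : 'rV[R]_n) (sg : bool).

Definition conf y : R := 2 * (1 + dot y y)^-1.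

Definition psi y : 'rV[R]_n := - conf y *: y.

Lemma conf_den_gt0 y : 0 < 1 + dot y y.
Proof. by rewrite ltr_wpDr // dot_ge0. Qed.

Lemma conf_gt0 y : 0 < conf y.
Proof. by rewrite mulr_gt0 // invr_gt0 conf_den_gt0. Qed.

Lemma conf_neq0 y : conf y != 0. Proof. by rewrite gt_eqF // conf_gt0. Qed.

Lemma conf_dot y : conf y * dot y y = 2 - conf y.
Proof.
by have := conf_den_gt0 y; rewrite /conf => /lt0r_neq0 ?; field.
Qed.

Lemma dot_psi y : dot (psi y) (psi y) = 2 * conf y - conf y ^+ 2.
Proof.
transitivity (conf y * (conf y * dot y y)); first by rewrite /psi !dot_lin; ring.
rewrite conf_dot; ring.
Qed.

Lemma has_diff_conf y : has_diff y (conf : _ -> R^o) (fun h => conf y * dot (psi y) h).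
Proof.
have d0 : 1 + dot y y != 0 by rewrite gt_eqF // conf_den_gt0.
have Dd : has_diff y (fun z => 1 + dot z z : R^o) (fun h => 0 + (dot h y + dot y h)).
  apply: has_diff_add; first exact: has_diff_const.
  exact: has_diff_dot (is_diff_id y) (is_diff_id y).
have /has_diff_ext := has_diff_mul (has_diff_const (2 : R^o) y) (has_diff_inv Dd d0).
apply=> // h; rewrite /psi !dot_lin /conf (dotC h); field.
exact: d0.
Qed.

Lemma has_diff_psi y :
  has_diff y psi (fun h => - conf y *: h + dot (psi y) h *: psi y).
Proof.
have /has_diff_ext := has_diff_scalev (has_diff_opp (has_diff_conf y)) (is_diff_id y).
apply=> // h; rewrite addrC; congr (_ + _).
by rewrite /psi scalerA; congr (_ *: _); ring.
Qed.

Lemma stereoE sg y :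
  stereo sg y = row_mx ((-1) ^+ sg * (1 - conf y))%:M (conf y *: y).
Proof.
have d0 : 1 + dot y y != 0 by rewrite gt_eqF // conf_den_gt0.
rewrite /stereo scale_row_mx scale_scalar_mx scalerA /conf; congr row_mx.
  by congr (_%:M); field.
by congr (_ *: _); rewrite mulrC.
Qed.

Lemma has_diff_stereo sg y :
  has_diff y (stereo sg) (fun h =>
    row_mx ((-1) ^+ sg * - (conf y * dot (psi y) h))%:M
      ((conf y * dot (psi y) h) *: y + conf y *: h)).
Proof.
have /has_diff_ext : has_diff y
    (fun z => row_mx ((-1) ^+ sg * (1 - conf z))%:M (conf z *: z))
    (fun h => row_mx ((-1) ^+ sg * - (conf y * dot (psi y) h))%:M
      ((conf y * dot (psi y) h) *: y + conf y *: h)); last first.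
  by apply=> // z; rewrite stereoE.
apply: has_diff_row_mx; last exact: has_diff_scalev (has_diff_conf y) (is_diff_id y).
apply: has_diff_row => i; rewrite ord1.
have /has_diff_ext := has_diff_mul (has_diff_const ((-1) ^+ sg : R^o) y)
  (has_diff_add (has_diff_const (1 : R^o) y) (has_diff_opp (has_diff_conf y))).
by apply=> z; rewrite mxE eqxx mulr1n // mul0r !add0r.
Qed.

Lemma sphere_metricE sg y : sphere_metric sg y = (conf y ^+ 2)%:M.
Proof.
apply/matrixP => i j; rewrite !mxE !(partial_row_diff _ (has_diff_stereo sg y)).
set a := delta_mx 0 i; set b := delta_mx 0 j.
have -> : conf y ^+ 2 *+ (i == j) = conf y ^+ 2 * dot a b.
  by rewrite dot_delta mxE eqxx /= -mulr_natr.
rewrite dot_row_mx dot_scalar /psi !dot_lin (dotC a y).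
have E : ((-1) ^+ sg * (-1) ^+ sg : R) = 1 by rewrite -expr2 sqrr_sign.
(* The sign of the pole enters only through its square, so both charts give the same metric. *)
rewrite [X in X + _](_ : _ = ((-1) ^+ sg * (-1) ^+ sg : R) *
  (conf y * (conf y * dot y a)) * (conf y * (conf y * dot y b))); last by ring.
have C := conf_dot y; have {}C : dot y y = (2 - conf y) / conf y.
  by rewrite -C mulrAC mulfV ?mul1r // conf_neq0.
rewrite E C; field; exact: conf_neq0.
Qed.

Lemma conf2_unit y : ((conf y ^+ 2)%:M : 'M[R]_n) \in unitmx.
Proof. by rewrite unitmxE det_scalar unitfE !expf_neq0 // conf_neq0. Qed.

Lemma has_diff_conf2 y :
  has_diff y (fun z => conf z ^+ 2 : R^o) (fun h => 2 * conf y ^+ 2 * dot (psi y) h).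
Proof.
have /has_diff_ext := has_diff_mul (has_diff_conf y) (has_diff_conf y).
apply=> // h; ring.
Qed.

(** By Koszul's formula: the derivative of [conf ^+ 2] along [h] is [2 * conf ^+ 2 * dot (psi y) h],
    so the conformal factor cancels and [Gam] remains. *)
Lemma sphere_connection sg y X u :
  connection_form (sphere_metric sg) y X u = Gam (psi y) X u.
Proof.
apply: dot_inj => W; have c0 : conf y ^+ 2 != 0 by rewrite expf_neq0 // conf_neq0.
apply: (mulfI c0); rewrite -form_scalar -(sphere_metricE sg) form_connection.
- have E p q : (fun z => form (sphere_metric sg z) p q : R^o) = (fun z => conf z ^+ 2 * dot p q).
    by apply/funext => z; rewrite sphere_metricE form_scalar.
  have D p q h : 'D_h (fun z => conf z ^+ 2 * dot p q : R^o) y =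
      2 * conf y ^+ 2 * dot (psi y) h * dot p q.
    rewrite (has_diffE _ (has_diff_mul (has_diff_conf2 y)
      (has_diff_const (dot p q : R^o) y))).
    by rewrite mulr0 addr0.
  by rewrite !E !D /lc_form !dot_lin (dotC u); field.
- by move=> z; rewrite sphere_metricE tr_scalar_mx.
- rewrite sphere_metricE; exact: conf2_unit.
- move=> a b.
  have -> : (fun z => sphere_metric sg z a b : R^o) = (fun z => conf z ^+ 2 * (a == b)%:R).
    by apply/funext => z; rewrite sphere_metricE mxE mulr_natr.
  by have [] := has_diff_mul (has_diff_conf2 y) (has_diff_const ((a == b)%:R : R^o) y).
Qed.

Lemma partial_sphere_metric sg y i j k :
  partial k (fun z => sphere_metric sg z i j) y =
  2 * conf y ^+ 2 * psi y 0 k * (i == j)%:R.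
Proof.
have -> : (fun z => sphere_metric sg z i j : R^o) = (fun z => conf z ^+ 2 * (i == j)%:R).
  by apply/funext => z; rewrite sphere_metricE mxE mulr_natr.
rewrite (partial_diff _ (has_diff_mul (has_diff_conf2 y)
  (has_diff_const ((i == j)%:R : R^o) y))).
by rewrite mulr0 addr0 dot_deltar.
Qed.

End StereographicChart.

(** * Killing fields in a chart *)

Section HasDiffLinear.
Context {R : realType} {V W : normedModType R}.

Lemma has_diffD (f df : V -> W) x a b : has_diff x f df -> df (a + b) = df a + df b.
Proof. by move=> [_ <-]; rewrite linearD. Qed.

Lemma has_diffZ (f df : V -> W) x k a : has_diff x f df -> df (k *: a) = k *: df a.
Proof. by move=> [_ <-]; rewrite linearZ. Qed.

Lemma has_diff_uniq (f df df' : V -> W) x h :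
  has_diff x f df -> has_diff x f df' -> df h = df' h.
Proof. by move=> [_ <-] [_ <-]. Qed.

End HasDiffLinear.

(** * Second derivatives of smooth vector-valued maps *)

Section SmoothVector.
Context {R : realType} {n : nat}.
Variable v : 'rV[R]_n -> 'rV[R]_n.
Hypothesis sv : forall i, smooth (fun y => v y 0 i).

Lemma smooth_has_diff y : has_diff y v (fun h => 'D_h v y).
Proof.
have D i : has_diff y (fun z => v z 0 i : R^o) (fun h => 'D_h (fun z => v z 0 i : R^o) y).
  by apply: has_diff_derive; exact: (is_Ck_differentiable (k := 0) _ (sv i 1)).
have [d _] : has_diff y v (fun h => \row_i 'D_h (fun z => v z 0 i : R^o) y).
  by apply: has_diff_row => i; have /has_diff_ext := D i; apply=> // h; rewrite mxE.
exact: has_diff_derive.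
Qed.

Lemma derive_coord y X i : 'D_X v y 0 i = \sum_j X 0 j * partial j (fun z => v z 0 i) y.
Proof.
rewrite -derive_partial; last exact: (is_Ck_differentiable (k := 0) _ (sv i 1)).
by rewrite (has_diffE _ (has_diff_coord i (smooth_has_diff y))).
Qed.

Lemma partial_coord y i j : partial j (fun z => v z 0 i) y = 'D_(delta_mx 0 j) v y 0 i.
Proof. by rewrite -(has_diffE _ (has_diff_coord i (smooth_has_diff y))). Qed.

Lemma smooth_derive_coord y X i :
  has_diff y (fun z => 'D_X v z 0 i : R^o) (fun Z =>
    \sum_j \sum_k X 0 j * Z 0 k * partial k (partial j (fun z => v z 0 i)) y).
Proof.
have D j : has_diff y (partial j (fun z => v z 0 i) : _ -> R^o)
    (fun h => 'D_h (partial j (fun z => v z 0 i) : _ -> R^o) y).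
  apply: has_diff_derive; have [_ C] := sv i 2.
  exact: (is_Ck_differentiable (k := 0) _ (C j)).
have /has_diff_ext := has_diff_sum (fun j =>
  has_diff_mul (has_diff_const (X 0 j : R^o) y) (D j)).
apply=> h; first by rewrite derive_coord.
apply: eq_bigr => j _; rewrite mul0r add0r derive_partial; last by have [] := D j.
by rewrite mulr_sumr; apply: eq_bigr => k _; rewrite mulrA.
Qed.

Lemma smooth_derive_has_diff y X :
  has_diff y (fun z => 'D_X v z) (fun Z => 'D_Z (fun z => 'D_X v z) y).
Proof.
have [d _] : has_diff y (fun z => 'D_X v z) (fun Z => \row_i
    \sum_j \sum_k X 0 j * Z 0 k * partial k (partial j (fun z => v z 0 i)) y).
  apply: has_diff_row => i; have /has_diff_ext := smooth_derive_coord y X i.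
  by apply=> // h; rewrite mxE.
exact: has_diff_derive.
Qed.

Lemma derive2_sym y X Z :
  'D_Z (fun z => 'D_X v z) y = 'D_X (fun z => 'D_Z v z) y.
Proof.
apply/rowP => i.
have E U T := has_diff_uniq T (has_diff_coord i (smooth_derive_has_diff y U))
  (smooth_derive_coord y U i).
apply: etrans (E X Z) (etrans _ (esym (E Z X))).
rewrite exchange_big; apply: eq_bigr => j _; apply: eq_bigr => k _ /=.
rewrite (partial_comm _ _ _ (sv i 2)); ring.
Qed.

End SmoothVector.

(** * The Killing equation and its second-order consequences *)

Section KillingChart.
Context {R : realType} {n : nat}.
Variable v : 'rV[R]_n -> 'rV[R]_n.
Implicit Types y X Y Z : 'rV[R]_n.

(** The Killing equation divided by [conf y ^+ 2]. For the flat metric, [v] is a conformal Killing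
    field; its factor [- dot (psi y) (v y)] comes from differentiating [conf] along [v]. *)
Definition killing_chart :=
  (forall i, smooth (fun y => v y 0 i)) /\
  forall y X Y, dot ('D_X v y) Y + dot ('D_Y v y) X =
    - 2 * dot (psi y) (v y) * dot X Y.

Hypothesis kv : killing_chart.

(* The differential of [- dot (psi y) (v y)], the conformal factor of [v]. *)
Definition dfactor y Z : R :=
  conf y * dot Z (v y) - dot (psi y) Z * dot (psi y) (v y) - dot (psi y) ('D_Z v y).

Lemma has_diff_factor y : has_diff y (fun z => - dot (psi z) (v z) : R^o) (dfactor y).
Proof.
have /has_diff_ext := has_diff_opp (has_diff_dot (has_diff_psi y) (smooth_has_diff kv.1 y)).
apply=> // h; rewrite /dfactor !dot_lin; ring.
Qed.

(** Derivative along [Z] of the equation in [killing_chart], with [X] and [Y] held constant. *)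
Lemma killing_derive2 y X Y Z :
  dot ('D_Z (fun z => 'D_X v z) y) Y + dot ('D_Z (fun z => 'D_Y v z) y) X =
  2 * dfactor y Z * dot X Y.
Proof.
have D U := smooth_derive_has_diff kv.1 y U.
have H1 := has_diff_add (has_diff_dot (D X) (has_diff_const Y y))
                        (has_diff_dot (D Y) (has_diff_const X y)).
have H2 := has_diff_mul (has_diff_mul (has_diff_const (2 : R^o) y) (has_diff_factor y))
                        (has_diff_const (dot X Y : R^o) y).
have E z : dot ('D_X v z) Y + dot ('D_Y v z) X = 2 * (- dot (psi z) (v z)) * dot X Y.
  rewrite kv.2; ring.
have := has_diff_uniq Z H1 (has_diff_ext H2 (fun z => esym (E z)) (fun=> erefl)).
by rewrite !dot0r !addr0 mulr0 mul0r add0r addr0.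
Qed.

(* The equations of [killing_derive2] for the three cyclic permutations are
   solved as in Koszul's formula. *)
Lemma killing_hessian y X Y Z :
  dot ('D_X (fun z => 'D_Y v z) y) Z =
  dfactor y X * dot Y Z + dfactor y Y * dot X Z - dfactor y Z * dot X Y.
Proof.
have alg (b1 b2 b3 f1 f2 f3 d1 d2 d3 : R) :
    b1 + b2 = 2 * f1 * d1 -> b1 + b3 = 2 * f2 * d2 -> b2 + b3 = 2 * f3 * d3 ->
    b1 = f1 * d1 + f2 * d2 - f3 * d3.
  by rewrite -!mulrA => *; lra.
have H1 := killing_derive2 y Y Z X.
have H2 := killing_derive2 y X Z Y.
have H3 := killing_derive2 y X Y Z.
rewrite (derive2_sym kv.1 y X Y) in H2.
rewrite (derive2_sym kv.1 y X Z) (derive2_sym kv.1 y Y Z) in H3.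
exact: alg H1 H2 H3.
Qed.

Lemma dfactor_sum y Z : \sum_i dfactor y (delta_mx 0 i) * Z 0 i = dfactor y Z.
Proof.
have [_ <-] := has_diff_factor y.
rewrite {2}(row_sum_delta Z) linear_sum; apply: eq_bigr => i _.
by rewrite linearZ mulrC.
Qed.

(** Trace of [killing_hessian]: for [X = Y] the i-th basis vector, the first two terms each sum to
    [dfactor y Z], and the last to [- n * dfactor y Z]. *)
Lemma killing_laplacian y Z :
  \sum_i dot ('D_(delta_mx 0 i) (fun z => 'D_(delta_mx 0 i) v z) y) Z =
  (2 - n%:R) * dfactor y Z.
Proof.
under eq_bigr => i _ do rewrite killing_hessian dot_delta [X in _ - _ * X]dot_delta mxE !eqxx.
rewrite sumrB big_split /= dfactor_sum.
by rewrite sumr_const card_ord mulr1 -mulr_natl; ring.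
Qed.

Lemma killing_diag y X : dot ('D_X v y) X = - dot (psi y) (v y) * dot X X.
Proof. have := kv.2 y X X; lra. Qed.

End KillingChart.

(** * The tension field *)

Section TensionDensity.
Context {R : realType} {V : lmodType R} (b : V -> V -> R).
Implicit Types (e w d p v Y q hy hu u : V) (c a : R).

Definition dpsi c p hy : V := - c *: hy + b p hy *: p.

(* [dK], [dt] and [dform] are the derivatives, in the direction [(hy, hu)] at
   the point [(y, u)], of the vertical part of [(X, x)], of [|u|^2] and of
   [G((X, x), (Y, y))]; here [a] and [a1] are the values of [A] and [A'] at
   [|u|^2]. *)
Definition dK c p u hy hu X : V :=
  (b (dpsi c p hy) u + b p hu) *: X + b (dpsi c p hy) X *: u
  + b p X *: hu - b X hu *: p - b X u *: dpsi c p hy.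

Definition dt c p u hy hu : R :=
  2 * c ^+ 2 * b p hy * b u u + 2 * c ^+ 2 * b u hu.

Definition dform c a (a1 : R) p u hy hu X x Y y : R :=
  a1 * dt c p u hy hu * c ^+ 2 * b X Y + 2 * a * c ^+ 2 * b p hy * b X Y
  + 2 * c ^+ 2 * b p hy * b (lc_form b p X u + x) (lc_form b p Y u + y)
  + c ^+ 2 * (b (dK c p u hy hu X) (lc_form b p Y u + y)
              + b (lc_form b p X u + x) (dK c p u hy hu Y)).

Hypothesis bC : forall X Y, b X Y = b Y X.
Hypothesis bD : forall X Y Z, b (X + Y) Z = b X Z + b Y Z.
Hypothesis bZ : forall k X Z, b (k *: X) Z = k * b X Z.

(* For [e] a coordinate vector, [w] and [d] the first and second derivatives of
   [v] along [e], the left side is [G] of the summand of the tension field and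
   [(Y, q)]; the right side collects the terms quadratic in [(e, w)], which are
   the ones to be summed over [e]. *)
Lemma tension_summand c a (a1 : R) e w d p v Y q :
  b e e = 1 -> b e w = - b p v -> b p p = 2 * c - c ^+ 2 ->
  c ^+ 2 * b d (lc_form b p Y v + q) + dform c a a1 p v e w e w Y q
  - 2^-1 * dform c a a1 p v Y q e w e w
  - (a * c ^+ 2 * b (2 * b p e *: e - p) Y
     + c ^+ 2 * b (lc_form b p (2 * b p e *: e - p) v + (2 * b p e) *: w)
                    (lc_form b p Y v + q)) =
  c ^+ 2 * (b d (lc_form b p Y v + q)
   + (2 * b p Y * b p v ^+ 2 - b p Y * b v v * a1 * c ^+ 2
      + b p Y * b v v * c - b p Y * b v v * c ^+ 2 + b p q * b p v
      - 2 * b p v * b v Y * c + b p v * b v Y * c ^+ 2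
      - b v q * a1 * c ^+ 2 + b v q * c - b v q * c ^+ 2)
   + (2 * b p v ^+ 2 + 2 * b v v * a1 * c ^+ 2) * (b e Y * b e p)
   - 2 * b p v * c * (b e Y * b e v)
   + 2 * b p v * (b e Y * b w p)
   + 2 * a1 * c ^+ 2 * (b e Y * b w v)
   - 2 * b p v * b v Y * (b e p * b e p)
   + 2 * b p v * (b e q * b e p)
   + (2 * b p Y * b p v + 2 * b v Y * c - 2 * b v Y * c ^+ 2)
       * (b e p * b e v)
   - 2 * b v Y * (b e p * b w p)
   + (c ^+ 2 - 2 * c) * (b e q * b e v)
   + 2 * (b e q * b w p)
   + (2 * c ^+ 2 - 2 * c) * b p Y * (b e v * b e v)
   - c ^+ 2 * (b e v * b w Y)
   + 2 * b p Y * (b e v * b w p)).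
Proof.
have bN X Z : b (- X) Z = - b X Z by rewrite -scaleN1r bZ mulN1r.
have bDr X Y0 Z : b Z (X + Y0) = b Z X + b Z Y0 by rewrite bC bD !(bC Z).
have bNr X Z : b Z (- X) = - b Z X by rewrite bC bN bC.
have bZr k X Z : b Z (k *: X) = k * b Z X by rewrite bC bZ bC.
have bpsi hy Z : b (dpsi c p hy) Z = - c * b hy Z + b p hy * b p Z.
  by rewrite /dpsi !(bD, bZ).
have bG X Z : b (lc_form b p X v) Z = b p v * b X Z + b p X * b v Z - b X v * b p Z.
  by rewrite /lc_form !(bD, bN, bZ).
have bGr X Z : b Z (lc_form b p X v) = b p v * b X Z + b p X * b v Z - b X v * b p Z.
  by rewrite bC bG.
have bdK hy hu X Z : b (dK c p v hy hu X) Z =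
    (b (dpsi c p hy) v + b p hu) * b X Z + b (dpsi c p hy) X * b v Z
    + b p X * b hu Z - b X hu * b p Z - b X v * b (dpsi c p hy) Z.
  by rewrite /dK !(bD, bN, bZ).
have bdKr hy hu X Z : b Z (dK c p v hy hu X) =
    (b (dpsi c p hy) v + b p hu) * b X Z + b (dpsi c p hy) X * b v Z
    + b p X * b hu Z - b X hu * b p Z - b X v * b (dpsi c p hy) Z.
  by rewrite bC bdK.
move=> ee ew pp; rewrite /dform /dt !(bdK, bdKr, bpsi).
rewrite !(bG, bGr, bD, bN, bZ, bDr, bNr, bZr).
(* Each symmetric pair is put in one order, so that [field] meets a single atom per product. *)
rewrite ?(bC w e) ?(bC p e) ?(bC v e) ?(bC Y e) ?(bC q e) ee ew.
rewrite ?(bC v p) ?(bC Y p) ?(bC q p) ?(bC p w) ?(bC Y v) ?(bC q v) pp.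
rewrite ?(bC v w) ?(bC Y w) ?(bC q w) ?(bC _ d).
by field.
Qed.

End TensionDensity.

(* The variables [w X] and [d i] stand for ['D_X v y] and for the second
   derivatives of [v], which unification would unfold down to a limit. *)
Section TensionSum.
Context {R : realType} {n : nat}.
Variables (w : 'rV[R]_n -> 'rV[R]_n) (d : 'I_n -> 'rV[R]_n).
Variables (p u : 'rV[R]_n) (c : R).
Implicit Types X Y Z : 'rV[R]_n.
Hypothesis wD : forall X Y, w (X + Y) = w X + w Y.
Hypothesis wZ : forall k X, w (k *: X) = k *: w X.
Hypothesis kw : forall X Y, dot (w X) Y + dot (w Y) X = - 2 * dot p u * dot X Y.
Hypothesis pp : dot p p = 2 * c - c ^+ 2.
Hypothesis lapl : forall Z, \sum_i dot (d i) Z =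
  (2 - n%:R) * (c * dot Z u - dot p Z * dot p u - dot p (w Z)).

Lemma sum_dot_delta X Z :
  \sum_i dot (delta_mx 0 i) X * dot (delta_mx 0 i) Z = dot X Z.
Proof. by rewrite dotE; apply: eq_bigr => i _; rewrite !dot_delta. Qed.

Lemma sum_dot_linear X Z :
  \sum_i dot (delta_mx 0 i) X * dot (w (delta_mx 0 i)) Z = dot (w X) Z.
Proof.
have w0 : w 0 = 0 by rewrite -[X in w X](scale0r 0) wZ scale0r.
rewrite [in RHS](row_sum_delta X) (big_morph w wD w0) dot_suml.
by apply: eq_bigr => i _; rewrite wZ dotZl dot_delta.
Qed.

Lemma linear_Gam Y q :
  w (Gam p Y u + q) = dot p u *: w Y + dot p Y *: w u - dot Y u *: w p + w q.
Proof. by rewrite /lc_form !wD -scaleN1r !wZ scaleN1r. Qed.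

Lemma dot_linear_diag X : dot (w X) X = - dot p u * dot X X.
Proof. have := kw X X; lra. Qed.

Lemma dot_linear_swap X Y : dot (w X) Y = - 2 * dot p u * dot X Y - dot (w Y) X.
Proof. have := kw X Y; lra. Qed.

(** Trace over the standard basis of the bracket in [tension_summand]. The added multiple of
    [dot (w p) Q] comes from the part [- psi] of the contracted Christoffel symbols. The sums reduce
    to products of the fixed vectors, and [lapl] and [kw] make all but two terms cancel. *)
Lemma tension_sum (a1 : R) Y q :
  let e i : 'rV[R]_n := delta_mx 0 i in let Q := Gam p Y u + q in
  \sum_i (dot (d i) Q
   + (2 * dot p Y * dot p u ^+ 2 - dot p Y * dot u u * a1 * c ^+ 2
      + dot p Y * dot u u * c - dot p Y * dot u u * c ^+ 2 + dot p q * dot p u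
      - 2 * dot p u * dot u Y * c + dot p u * dot u Y * c ^+ 2
      - dot u q * a1 * c ^+ 2 + dot u q * c - dot u q * c ^+ 2)
   + (2 * dot p u ^+ 2 + 2 * dot u u * a1 * c ^+ 2) * (dot (e i) Y * dot (e i) p)
   - 2 * dot p u * c * (dot (e i) Y * dot (e i) u)
   + 2 * dot p u * (dot (e i) Y * dot (w (e i)) p)
   + 2 * a1 * c ^+ 2 * (dot (e i) Y * dot (w (e i)) u)
   - 2 * dot p u * dot u Y * (dot (e i) p * dot (e i) p)
   + 2 * dot p u * (dot (e i) q * dot (e i) p)
   + (2 * dot p Y * dot p u + 2 * dot u Y * c - 2 * dot u Y * c ^+ 2)
       * (dot (e i) p * dot (e i) u)
   - 2 * dot u Y * (dot (e i) p * dot (w (e i)) p)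
   + (c ^+ 2 - 2 * c) * (dot (e i) q * dot (e i) u)
   + 2 * (dot (e i) q * dot (w (e i)) p)
   + (2 * c ^+ 2 - 2 * c) * dot p Y * (dot (e i) u * dot (e i) u)
   - c ^+ 2 * (dot (e i) u * dot (w (e i)) Y)
   + 2 * dot p Y * (dot (e i) u * dot (w (e i)) p))
  + n%:R * dot (w p) Q =
  c ^+ 2 * ((2 * a1 + 1) * (dot (w Y) u + dot p Y * dot u u)
            - (n%:R * a1 + n%:R - 1) * dot u Q).
Proof.
(* The part independent of [i] is hidden under one name, so that splitting the sum leaves it whole;
   it contributes [n] times its value. *)
move=> e Q; set k0 := (_ - dot u q * c ^+ 2).
have Ek : k0 = k0 := erefl; rewrite {2}/k0 in Ek; clearbody k0.
rewrite !big_split /= !sumrN -!mulr_sumr !sum_dot_delta !sum_dot_linear.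
rewrite sumr_const card_ord -[k0 *+ n]mulr_natl lapl Ek.
rewrite (dotC p (w Q)) /Q linear_Gam /lc_form !dot_lin.
rewrite (dot_linear_swap p u) (dot_linear_swap p Y) (dot_linear_swap p q).
rewrite (dot_linear_swap u Y) (dot_linear_diag p).
rewrite (dotC Y u) (dotC Y p) (dotC q p) (dotC u p) (dotC q u) pp.
ring.
Qed.

End TensionSum.

(** * The Kaluza-Klein metric with [B = 1] and [C = 0] in an induced chart *)

Section KaluzaKlein.
Context {R : realType} {n : nat}.
Implicit Types (y p u X Y : 'rV[R]_n) (z U W : 'rV[R]_(n + n)) (A : R -> R).

Definition Gam_mx p u : 'M[R]_n := (dot p u)%:M + p^T *m u - u^T *m p.

Lemma mul_Gam_mx p u X : X *m Gam_mx p u = Gam p X u.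
Proof.
rewrite /Gam_mx /lc_form mulmxBr mulmxDr mul_mx_scalar !mulmxA.
rewrite (mx11_scalar (X *m p^T)) (mx11_scalar (X *m u^T)) !mul_scalar_mx.
by rewrite -/(dot X p) (dotC X p).
Qed.

Definition hproj : 'M[R]_(n + n, n) := col_mx 1%:M 0.

Definition vproj z : 'M[R]_(n + n, n) :=
  col_mx (Gam_mx (psi (lsubmx z)) (rsubmx z)) 1%:M.

(** The connector of the Levi-Civita connection: it kills horizontal lifts and sends [vlift q] to
    [q]. *)
Definition vpart z U : 'rV[R]_n :=
  Gam (psi (lsubmx z)) (lsubmx U) (rsubmx z) + rsubmx U.

Definition norm2 z : R := conf (lsubmx z) ^+ 2 * dot (rsubmx z) (rsubmx z).

(** A weighted sum of two squares: [hproj] is the matrix of the differential of the bundle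
    projection, [vproj z] that of the connector. *)
Definition kk_metric A z : 'M[R]_(n + n) :=
  (A (norm2 z) * conf (lsubmx z) ^+ 2) *: (hproj *m hproj^T)
  + conf (lsubmx z) ^+ 2 *: (vproj z *m (vproj z)^T).

Lemma mul_hproj U : U *m hproj = lsubmx U.
Proof. by rewrite -{1}(hsubmxK U) mul_row_col mulmx1 mulmx0 addr0. Qed.

Lemma mul_vproj z U : U *m vproj z = vpart z U.
Proof. by rewrite -{1}(hsubmxK U) mul_row_col mulmx1 mul_Gam_mx. Qed.

Lemma form_kk A z U W : form (kk_metric A z) U W =
  A (norm2 z) * conf (lsubmx z) ^+ 2 * dot (lsubmx U) (lsubmx W)
  + conf (lsubmx z) ^+ 2 * dot (vpart z U) (vpart z W).
Proof.
rewrite /form /kk_metric mulmxDr mulmxDl -!scalemxAr -!scalemxAl.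
rewrite [LHS]mxE [X in X + _]mxE [X in _ + X]mxE -!mulmxA -!trmx_mul !mulmxA.
by rewrite !mul_hproj !mul_vproj.
Qed.

Lemma kk_sym A z : (kk_metric A z)^T = kk_metric A z.
Proof. by rewrite /kk_metric linearD !linearZ /= !trmx_mul !trmxK. Qed.

Lemma norm2_ge0 z : 0 <= norm2 z.
Proof. by rewrite mulr_ge0 ?dot_ge0 // exprn_ge0 // ltW // conf_gt0. Qed.

(** If the horizontal component of [U] vanishes, the connector returns its vertical component; hence
    one of the two squares is positive. *)
Lemma kk_pos A z U : (forall t, 0 <= t -> 0 < A t) -> U != 0 ->
  0 < form (kk_metric A z) U U.
Proof.
move=> A0 U0; rewrite form_kk.
have c0 : 0 < conf (lsubmx z) ^+ 2 by rewrite exprn_gt0 // conf_gt0.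
have a0 := A0 _ (norm2_ge0 z).
have [l0|l0] := eqVneq (lsubmx U) 0; last first.
  apply: ltr_wpDr; first by rewrite mulr_ge0 ?dot_ge0 // ltW.
  by apply: mulr_gt0; [exact: mulr_gt0|exact: dot_gt0].
rewrite /vpart l0 dot0l mulr0 add0r mulr_gt0 //.
have -> : Gam (psi (lsubmx z)) 0 (rsubmx z) = 0.
  by rewrite /lc_form !dot0l dot0r scaler0 !scale0r subr0 addr0.
rewrite add0r dot_gt0 //; apply: contra_neq U0 => r0.
by rewrite -(hsubmxK U) l0 r0 row_mx0.
Qed.

Lemma posdef_unitmx m (S : 'M[R]_m) :
  (forall X : 'rV_m, X != 0 -> 0 < form S X X) -> S \in unitmx.
Proof.
move=> H; rewrite -row_free_unit -kermx_eq0; apply/rowV0P => X /sub_kermxP XS.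
apply/eqP/negPn/negP => /H; rewrite /form XS mul0mx mxE ltxx //.
Qed.

End KaluzaKlein.

(** * Differentials of the metric on the tangent bundle *)

Section KaluzaKleinDiff.
Context {R : realType} {n : nat}.
Implicit Types (y p u X Y : 'rV[R]_n) (z U W h : 'rV[R]_(n + n)) (A : R -> R).

Lemma is_derive_has_diff A t (a1 : R) :
  is_derive (t : R^o) 1 (A : R^o -> R^o) a1 ->
  has_diff (t : R^o) (A : R^o -> R^o) (fun s => s * a1).
Proof.
move=> [d E]; have D : differentiable (A : R^o -> R^o) (t : R^o) by exact/derivable1_diffP.
split=> //; apply/funext => s; rewrite -deriveE // -E !deriveE //.
by rewrite -[in LHS](mulr1 s) [_ * 1](_ : _ = s *: (1 : R^o)) // linearZ.
Qed.

Lemma has_diff_conf2_l z : has_diff z (fun z => conf (lsubmx z) ^+ 2 : R^o)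
  (fun h => 2 * conf (lsubmx z) ^+ 2 * dot (psi (lsubmx z)) (lsubmx h)).
Proof. exact: (has_diff_comp_fun (has_diff_lsub z) (has_diff_conf2 (lsubmx z))). Qed.

Lemma has_diff_norm2 z : has_diff z (norm2 : _ -> R^o) (fun h =>
  dt (@dot R n) (conf (lsubmx z)) (psi (lsubmx z)) (rsubmx z) (lsubmx h) (rsubmx h)).
Proof.
have /has_diff_ext := has_diff_mul (has_diff_conf2_l z)
  (has_diff_dot (has_diff_rsub z) (has_diff_rsub z)).
apply=> // h; rewrite /dt (dotC (rsubmx h)); ring.
Qed.

Lemma has_diff_vpart z U : has_diff z (vpart ^~ U) (fun h =>
  dK (@dot R n) (conf (lsubmx z)) (psi (lsubmx z)) (rsubmx z) (lsubmx h) (rsubmx h)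
    (lsubmx U)).
Proof.
have Dp := has_diff_comp_fun (has_diff_lsub z) (has_diff_psi (lsubmx z)).
have Du := has_diff_rsub z.
have C (a : 'rV[R]_n) := has_diff_const a z.
pose X := lsubmx U.
have /has_diff_ext := has_diff_add (has_diff_add (has_diff_add
  (has_diff_scalev (has_diff_dot Dp Du) (C X))
  (has_diff_scalev (has_diff_dot Dp (C X)) Du))
  (has_diff_opp (has_diff_scalev (has_diff_dot (C X) Du) Dp))) (C (rsubmx U)).
apply=> // h; rewrite addr0 !scaler0 !dot0r !dot0l !addr0 !add0r /dK /dpsi.
by rewrite opprD -!addrA; do !congr (_ + _).
Qed.

Lemma has_diff_form_kk A z (a1 : R) U W :
  is_derive (norm2 z : R^o) 1 (A : R^o -> R^o) a1 ->
  has_diff z (fun z => form (kk_metric A z) U W : R^o) (fun h =>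
    dform (@dot R n) (conf (lsubmx z)) (A (norm2 z)) a1 (psi (lsubmx z)) (rsubmx z)
      (lsubmx h) (rsubmx h) (lsubmx U) (rsubmx U) (lsubmx W) (rsubmx W)).
Proof.
move=> DA; have DA2 := has_diff_comp_fun (has_diff_norm2 z) (is_derive_has_diff DA).
have Dc := has_diff_conf2_l z.
have /has_diff_ext := has_diff_add
  (has_diff_mul (has_diff_mul DA2 Dc) (has_diff_const (dot (lsubmx U) (lsubmx W) : R^o) z))
  (has_diff_mul Dc (has_diff_dot (has_diff_vpart z U) (has_diff_vpart z W))).
apply=> h; first by rewrite form_kk.
rewrite /dform -!/(vpart z _).
move: (dK _ _ _ _ _ _ _) (dK _ _ _ _ _ _ _) (dt _ _ _ _ _ _) => k1 k2 k3.
ring.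
Qed.

Lemma differentiable_kk A z (a1 : R) a b :
  is_derive (norm2 z : R^o) 1 (A : R^o -> R^o) a1 ->
  differentiable (fun z => kk_metric A z a b : R^o) z.
Proof.
move=> DA; have [d _] := has_diff_form_kk (delta_mx 0 a) (delta_mx 0 b) DA.
suff -> : (fun z => kk_metric A z a b : R^o) =
  (fun z => form (kk_metric A z) (delta_mx 0 a) (delta_mx 0 b)) by [].
by apply/funext => x; rewrite -[form _ _ _]/(dot (_ *m _) _) dot_deltar -rowE [RHS]mxE.
Qed.

End KaluzaKleinDiff.

(** * The tension field of a Killing section *)

Section Tension.
Context {R : realType} {n : nat}.
Variable v : 'rV[R]_n -> 'rV[R]_n.
Hypothesis kv : killing_chart v.
Variables (sg : bool) (A : R -> R) (y : 'rV[R]_n) (a1 : R).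
Hypothesis A0 : forall t, 0 <= t -> 0 < A t.
Let f (x : 'rV[R]_n) : 'rV[R]_(n + n) := row_mx x (v x).
Hypothesis DA : is_derive (norm2 (f y) : R^o) 1 (A : R^o -> R^o) a1.

Lemma has_diff_section x : has_diff x f (fun h => row_mx h ('D_h v x)).
Proof. exact: has_diff_row_mx (is_diff_id x) (smooth_has_diff kv.1 x). Qed.

Lemma partial_row_section i :
  partial_row i f = fun x => row_mx (delta_mx 0 i) ('D_(delta_mx 0 i) v x).
Proof. by apply/funext => x; rewrite (partial_row_diff _ (has_diff_section x)). Qed.

Lemma partial_row2_section i :
  partial_row i (partial_row i f) y =
  row_mx 0 ('D_(delta_mx 0 i) (fun z => 'D_(delta_mx 0 i) v z) y).
Proof.
rewrite partial_row_section.
exact: (partial_row_diff _ (has_diff_row_mx (has_diff_const (delta_mx 0 i) y)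
  (smooth_derive_has_diff kv.1 y (delta_mx 0 i)))).
Qed.

(** The symbols with both lower indices [i] are the components of
    [Gam (psi y) e e = 2 (psi, e) e - psi], for [e] the i-th basis vector; contracting them with the
    partial derivatives of [f] applies the differential of [f] to this vector. *)
Lemma christoffel_section i :
  \sum_k christoffel (sphere_metric sg) k i i y *: partial_row k f y =
  let G := 2 * dot (psi y) (delta_mx 0 i) *: delta_mx 0 i - psi y in
  row_mx G ('D_G v y).
Proof.
have E k : christoffel (sphere_metric sg) k i i y =
    (2 * dot (psi y) (delta_mx 0 i) *: delta_mx 0 i - psi y) 0 k.
  have <- : connection_form (sphere_metric sg) y (delta_mx 0 i) (delta_mx 0 i) =
      2 * dot (psi y) (delta_mx 0 i) *: delta_mx 0 i - psi y.
    rewrite sphere_connection /lc_form dot_delta mxE !eqxx scale1r.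
    by rewrite -scalerDl -mulr2n mulr_natl.
  have z j : j != i -> (delta_mx 0 i : 'rV[R]_n) 0 j = 0.
    by move=> ji; rewrite mxE (negbTE ji) andbF.
  rewrite mxE (bigD1 i) //= [X in _ + X]big1 => [|j ji]; last first.
    by rewrite big1 // => l _; rewrite (z _ ji) mulr0 mul0r.
  rewrite addr0 (bigD1 i) //= big1 => [|j ji]; last by rewrite (z _ ji) mulr0.
  by rewrite addr0 mxE !eqxx !mulr1.
have [_ D] := has_diff_section y.
rewrite /=; set G := (X in row_mx X _).
rewrite -[RHS]/((fun h => row_mx h ('D_h v y)) G) -D [in RHS](row_sum_delta G).
rewrite linear_sum; apply: eq_bigr => k _.
by rewrite linearZ E D partial_row_section.
Qed.

Lemma formDl m (S : 'M[R]_m) (X Y Z : 'rV[R]_m) : form S (X + Y) Z = form S X Z + form S Y Z.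
Proof. by rewrite /form !mulmxDl mxE. Qed.

Lemma formNl m (S : 'M[R]_m) (X Z : 'rV[R]_m) : form S (- X) Z = - form S X Z.
Proof. by rewrite /form !mulNmx mxE. Qed.

Lemma formZl m (S : 'M[R]_m) k (X Z : 'rV[R]_m) : form S (k *: X) Z = k * form S X Z.
Proof. by rewrite /form -!scalemxAl mxE. Qed.

Lemma form_suml m (S : 'M[R]_m) (F : 'I_n -> 'rV[R]_m) (Z : 'rV[R]_m) :
  form S (\sum_i F i) Z = \sum_i form S (F i) Z.
Proof. by rewrite /form !mulmx_suml summxE. Qed.

Lemma tension_trace :
  tension (sphere_metric sg) (kk_metric A) f y =
  (conf y ^+ 2)^-1 *: \sum_i nabla_d (sphere_metric sg) (kk_metric A) f i i y.
Proof.
rewrite /tension sphere_metricE invmx_scalar scaler_sumr; apply: eq_bigr => i _.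
rewrite (bigD1 i) //= big1 ?addr0 => [|j ji]; first by rewrite mxE eqxx.
by rewrite mxE eq_sym (negbTE ji) scale0r.
Qed.

(* [a1] is [A'] at the squared norm of [v y]; the two terms are the horizontal
   and the vertical part of the tension field. *)
Lemma form_tension (W : 'rV[R]_(n + n)) :
  let u := v y in let Y := lsubmx W in
  form (kk_metric A (f y)) (tension (sphere_metric sg) (kk_metric A) f y) W =
  conf y ^+ 2 * ((2 * a1 + 1) * (dot ('D_Y v y) u + dot (psi y) Y * dot u u)
            - (n%:R * a1 + n%:R - 1) * dot u (vpart (f y) W)).
Proof.
move=> u Y; set q := rsubmx W; set p := psi y; set c := conf y.
have ly : lsubmx (f y) = y by rewrite row_mxKl.
have ry : rsubmx (f y) = u by rewrite row_mxKr.
have c0 : c ^+ 2 != 0 by rewrite expf_neq0 // conf_neq0.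
have kU : kk_metric A (f y) \in unitmx.
  by apply: posdef_unitmx => X; exact: kk_pos.
have fkk (X x Z z : 'rV[R]_n) : form (kk_metric A (f y)) (row_mx X x) (row_mx Z z) =
  A (norm2 (f y)) * c ^+ 2 * dot X Z + c ^+ 2 * dot (Gam p X u + x) (Gam p Z u + z).
  by rewrite form_kk /vpart ly ry !row_mxKl !row_mxKr.
have Dkk h U Z : 'D_h (fun z => form (kk_metric A z) U Z : R^o) (f y) =
   dform (@dot R n) c (A (norm2 (f y))) a1 p u (lsubmx h) (rsubmx h)
      (lsubmx U) (rsubmx U) (lsubmx Z) (rsubmx Z).
  by rewrite (has_diffE _ (has_diff_form_kk U Z DA)) ly ry.
have Dv := smooth_has_diff kv.1 y.
rewrite tension_trace formZl form_suml.
pose e i : 'rV[R]_n := delta_mx 0 i; pose w X := 'D_X v y.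
pose d i := 'D_(e i) (fun z => 'D_(e i) v z) y.
have wD X Z : w (X + Z) = w X + w Z by exact: has_diffD Dv.
have wZ k X : w (k *: X) = k *: w X by exact: has_diffZ Dv.
have kw X Z : dot (w X) Z + dot (w Z) X = - 2 * dot p u * dot X Z by exact: kv.2.
have pp : dot p p = 2 * c - c ^+ 2 by exact: dot_psi.
have ee i : dot (e i) (e i) = 1 by rewrite dot_delta mxE !eqxx.
have ew i : dot (e i) (w (e i)) = - dot p u.
  by rewrite dotC (killing_diag kv) ee mulr1.
(* In Koszul's formula both arguments are the i-th partial derivative of [f]: the first two terms
   coincide, which gives [dform] with coefficient 1, and the third has coefficient -1/2. The last
   summand is split off from the Christoffel term. *)
have term i : form (kk_metric A (f y))
    (nabla_d (sphere_metric sg) (kk_metric A) f i i y) W =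
  c ^+ 2 * dot (d i) (Gam p Y u + q)
  + dform (@dot R n) c (A (norm2 (f y))) a1 p u (e i) (w (e i)) (e i) (w (e i)) Y q
  - 2^-1 * dform (@dot R n) c (A (norm2 (f y))) a1 p u Y q (e i) (w (e i)) (e i) (w (e i))
  - (A (norm2 (f y)) * c ^+ 2 * dot (2 * dot p (e i) *: e i - p) Y
     + c ^+ 2 * dot (Gam p (2 * dot p (e i) *: e i - p) u + (2 * dot p (e i)) *: w (e i))
                    (Gam p Y u + q)) + c ^+ 2 * dot (w p) (Gam p Y u + q).
  rewrite /nabla_d christoffel_section partial_row2_section.
  rewrite !formDl formNl form_connection //; last 2 first.
  - exact: kk_sym.
  - by move=> a b; exact: differentiable_kk DA.
  rewrite !Dkk partial_row_section !row_mxKl !row_mxKr -[in LHS](hsubmxK W) !fkk.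
  rewrite hsubmxK -/Y -/q -/p -/(e i) -/(w (e i)) -/(d i).
  have -> : 'D_(2 * dot p (e i) *: e i - p) v y = 2 * dot p (e i) *: w (e i) - w p.
    by rewrite -/(w _) wD -scaleN1r !wZ scaleN1r.
  have -> : Gam p 0 u = 0 by rewrite /lc_form !dot0l dot0r scaler0 !scale0r subr0 addr0.
  move: (w (e i)) (d i) (w p) (e i) (Gam p Y u + q) => wi di wp ei Q.
  rewrite add0r dot0l (addrA _ _ (- wp)) [dot (_ - wp) _]dotDl dotNl.
  move: (dform _ _ _ _ _ _ _ _ _ _ _ _) (dform _ _ _ _ _ _ _ _ _ _ _ _) => F1 F2.
  move: (dot _ Q) (dot _ Q) (dot _ Q) (dot _ Y) => b1 b2 b3 b4.
  by field.
under eq_bigr => i _ do rewrite term (@tension_summand _ _ (@dot R n) (@dotC R n)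
  (@dotDl R n) (@dotZl R n) _ _ _ _ _ _ _ _ _ _ (ee i) (ew i) pp).
have -> : vpart (f y) W = Gam p Y u + q by rewrite /vpart ly ry.
apply: etrans (@tension_sum R n w d p u c wD wZ kw pp (killing_laplacian kv y) a1 Y q).
rewrite big_split /= -mulr_sumr sumr_const card_ord -[_ *+ n]mulr_natl.
rewrite /e /= -/c; set s := (\sum_i _); set t := dot (w p) _; clearbody s t; field.
exact: conf_neq0.
Qed.

End Tension.

(** * Components of a vector field *)

Section Components.
Context {R : realType} {n : nat}.
Variable xi : 'rV[R]_(1 + n) -> 'rV[R]_(1 + n).
Implicit Types (sg : bool) (y X Y : 'rV[R]_n).

(** The metric is a multiple of the identity, so on basis vectors each sum of derivatives of [v]
    reduces to one term; bilinearity does the rest. *)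
Lemma killing_chart_components sg : killing_field xi -> killing_chart (components xi sg).
Proof.
move=> [_ sxi kxi]; split; first exact: sxi.
move=> y; set v := components xi sg; set w := fun X => 'D_X v y.
have Dv : has_diff y v w by exact: smooth_has_diff (sxi sg) y.
have c0 : conf y ^+ 2 != 0 by rewrite expf_neq0 // conf_neq0.
have K i j : w (delta_mx 0 i) 0 j + w (delta_mx 0 j) 0 i =
    - 2 * dot (psi y) (v y) * (i == j)%:R.
  have := kxi sg y i j; rewrite /= -/v !big_split /=.
  under eq_bigr => k _ do rewrite partial_sphere_metric.
  under [X in _ + X + _]eq_bigr => k _ do rewrite (partial_coord (sxi sg)) -/v -/(w _).
  under [X in _ + _ + X]eq_bigr => k _ do rewrite (partial_coord (sxi sg)) -/v -/(w _).
  rewrite [X in _ + X + _](bigD1 j) //= [X in _ + (_ + X) + _]big1 => [|k kj]; last first.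
    by rewrite sphere_metricE mxE (negbTE kj) mul0r.
  rewrite [X in _ + _ + X](bigD1 i) //= [X in _ + _ + (_ + X)]big1 => [|k kj]; last first.
    by rewrite sphere_metricE mxE eq_sym (negbTE kj) mul0r.
  rewrite sphere_metricE !mxE !eqxx !addr0 !mulr1n.
  have -> : \sum_k v y 0 k * (2 * conf y ^+ 2 * psi y 0 k * (i == j)%:R) =
      conf y ^+ 2 * (2 * dot (psi y) (v y) * (i == j)%:R).
    by rewrite dotE !(mulr_sumr, mulr_suml); apply: eq_bigr => k _; ring.
  rewrite -!mulrDr => /eqP; rewrite mulf_eq0 (negbTE c0) /= -addrA addr_eq0 => /eqP E.
  by rewrite -[LHS]opprK -E; ring.
have E X Y : dot (w X) Y = \sum_i \sum_j X 0 i * Y 0 j * w (delta_mx 0 i) 0 j.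
  have [_ D] := Dv.
  rewrite -D {1}(row_sum_delta X) linear_sum dot_suml; apply: eq_bigr => i _.
  by rewrite linearZ dotZl D dotE mulr_sumr; apply: eq_bigr => j _; ring.
suff S : forall X Y, dot (w X) Y + dot (w Y) X = - 2 * dot (psi y) (v y) * dot X Y.
  by move=> X Y; exact: S.
clearbody w; move=> X Y; rewrite !E [X in _ + X]exchange_big /= -big_split /=.
rewrite (dotE X) mulr_sumr; apply: eq_bigr => i _; rewrite -big_split /=.
rewrite (bigD1 i) //= big1 => [|j ji].
  rewrite addr0 [Y 0 i * _]mulrC -mulrDr K eqxx mulr1; ring.
by rewrite [Y 0 j * _]mulrC -mulrDr K eq_sym (negbTE ji) !mulr0.
Qed.

Definition stereo_mx sg y : 'M[R]_(n, 1 + n) := \matrix_i partial_row i (stereo sg) y.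

Lemma stereo_mxE sg y i k : stereo_mx sg y i k = partial_row i (stereo sg) y 0 k.
Proof. by rewrite mxE. Qed.

Lemma stereo_mx_gram sg y : stereo_mx sg y *m (stereo_mx sg y)^T = (conf y ^+ 2)%:M.
Proof.
rewrite -(sphere_metricE sg); apply/matrixP => i j; rewrite mxE [RHS]mxE dotE.
by apply: eq_bigr => k _; rewrite [X in _ * X]mxE !stereo_mxE.
Qed.

(** Derivative of the constant [dot (stereo sg y) (stereo sg y) = 1]. *)
Lemma stereo_mx_normal sg y : stereo_mx sg y *m (stereo sg y)^T = 0.
Proof.
apply/colP => i; rewrite !mxE.

have H := has_diff_stereo sg y.
have D := has_diffE (delta_mx 0 i) (has_diff_dot H H).
have E : (fun z : 'rV[R]_n => dot (stereo sg z) (stereo sg z) : R^o) = fun=> 1.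
  by apply/funext => z; exact: stereo_on_sphere.
rewrite E (has_diffE _ (has_diff_const (1 : R^o) y)) -(partial_row_diff i H) in D.
rewrite [X in _ = _ + X]dotC in D.
have D0 (t : R) : 0 = t + t -> t = 0 by move=> ?; lra.
by rewrite -[RHS](D0 _ D) dotE; apply: eq_bigr => k _; rewrite !mxE.
Qed.

Lemma componentsE sg y :
  components xi sg y = (conf y ^+ 2)^-1 *: (xi (stereo sg y) *m (stereo_mx sg y)^T).
Proof.
rewrite /components sphere_metricE invmx_scalar mul_mx_scalar; congr (_ *: _).
by apply/rowP => j; rewrite !mxE dotE; apply: eq_bigr => k _; rewrite !mxE.
Qed.

Lemma dot_components sg y : tangent_field xi ->
  dot (xi (stereo sg y)) (xi (stereo sg y)) =
  conf y ^+ 2 * dot (components xi sg y) (components xi sg y).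
Proof.
move=> txi; set x := stereo sg y; set J := stereo_mx sg y; set v := components xi sg y.
have c0 : conf y ^+ 2 != 0 by rewrite expf_neq0 // conf_neq0.
have xx : x *m x^T = 1%:M.
  rewrite [LHS]mx11_scalar; congr (_%:M); exact: stereo_on_sphere.
have Jx : J *m x^T = 0 by exact: stereo_mx_normal.
have xJ : x *m J^T = 0 by rewrite -[LHS]trmxK trmx_mul trmxK Jx trmx0.
pose K : 'M[R]_(1 + n) := col_mx x J.
pose D : 'M[R]_(1 + n) := block_mx 1%:M 0 0 ((conf y ^+ 2)^-1)%:M.
(* [D] inverts the Gram matrix of the orthogonal frame made of [x] and the coordinate vectors. As
   [K] is square, this right inverse is also a left one and expands [xi x] in the frame; tangency
   removes the component along [x]. *)
have KD : K *m (K^T *m D) = 1%:M.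
  rewrite mulmxA /K tr_col_mx mul_col_row xx Jx xJ stereo_mx_gram mulmx_block.
  rewrite !mulmx0 !mul0mx !addr0 !add0r mulmx1 -scalar_mxM mulfV //.
  by rewrite -scalar_mx_block.
have xiE : xi x = v *m J.
  rewrite -[LHS]mulmx1 -(mulmx1C KD) /K tr_col_mx mulmxA (mulmxA (xi x)) mul_mx_row.
  have -> : xi x *m x^T = 0.
    by rewrite [LHS]mx11_scalar -[_ 0 0]/(dot (xi x) x) txi ?raddf0 //; exact: stereo_on_sphere.
  rewrite mul_row_block !mul0mx !mulmx0 !add0r mul_row_col mul0mx add0r.
  by rewrite mul_mx_scalar -componentsE.
by rewrite xiE dot_mulmx -mulmxA stereo_mx_gram mul_mx_scalar dotZr.
Qed.

End Components.

(** * The function A *)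

Section Cutoff.
Context {R : realType}.
Implicit Types (f : R -> R) (s t l K : R).

(** Caratheodory's slope function differs from [l] by at most [K * |s - t|]. Piecewise polynomials
    are thus differentiated by inequalities alone. *)
Lemma quadratic_is_derive f t l K : 0 <= K ->
  (forall s, `|s - t| <= 1 -> `|f s - f t - l * (s - t)| <= K * (s - t) ^+ 2) ->
  is_derive (t : R^o) 1 (f : R^o -> R^o) l.
Proof.
move=> K0 H; apply/is_derive1_caratheodory.
exists (fun s => if s == t then l else (f s - f t) / (s - t)); split.
- move=> s; case: eqP => [->|/eqP st]; first by rewrite !subrr mulr0.
  by rewrite divfK // subr_eq0.
- apply/cvgrPdist_le => /= e e0; rewrite eqxx.
  (* The 1 is the radius where the bound holds; [K + 1] is positive even for [K = 0]. *)
  have d0 : 0 < Num.min 1 (e / (K + 1)).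
    by rewrite lt_min ltr01 divr_gt0 // ltr_wpDl.
  apply/nbhs_ballP; exists (Num.min 1 (e / (K + 1))) => //= s.
  rewrite /ball_ /= distrC lt_min => /andP[/ltW s1 /ltW se].
  case: eqP => [_|/eqP st]; first by rewrite subrr normr0 ltW.
  have st0 : s - t != 0 by rewrite subr_eq0.
  have -> : l - (f s - f t) / (s - t) = - ((f s - f t - l * (s - t)) / (s - t)) by field.
  rewrite normrN normrM normfV ler_pdivrMr ?normr_gt0 //.
  apply: le_trans (H s s1) _.
  have -> : (s - t) ^+ 2 = `|s - t| * `|s - t| by rewrite -expr2 real_normK // num_real.
  rewrite mulrA ler_wpM2r //.
  move: se; rewrite ler_pdivlMr ?ltr_wpDl // mulrC => /(le_trans _); apply.
  by rewrite ler_wpM2r // lerDl.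
- by rewrite eqxx.
Qed.

Lemma is_derive_ge0 f f' :
  (forall t, is_derive (t : R^o) 1 (f : R^o -> R^o) (f' t)) -> derivative_ge0 f f'.
Proof.
move=> D t _; have /is_derive1_caratheodory[g [Eg cg gt]] := D t.
suff H : (fun s : R => (f s - f t) / (s - t)) @ t^' --> (f' t : R^o).
  by move=> S /H HS; exact: (@cvg_within _ t^' _ [set s : R | 0 <= s] _ HS).
apply/cvgrPdist_le => /= e e0; rewrite -gt.
move/cvgrPdist_le : cg => /(_ e e0) cg.
near=> s.
have st : s != t by near: s; exact: nbhs_dnbhs_neq.
rewrite Eg mulfK ?subr_eq0 //.
near: s; exact: cvg_within cg.
Unshelve. all: by end_near. Qed.

(** The positive part; its cube is its lowest power of class C^2. *)
Definition ramp t : R := if 0 <= t then t else 0.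

Lemma ramp_ge0 t : 0 <= ramp t. Proof. by rewrite /ramp; case: ifP. Qed.

Lemma is_derive_ramp2 t :
  is_derive (t : R^o) 1 (fun s : R^o => ramp s ^+ 2 : R^o) (2 * ramp t).
Proof.
apply: (@quadratic_is_derive _ _ _ 1) => // s _; rewrite mul1r ler_norml.
have := sqr_ge0 s; have := sqr_ge0 t; have := sqr_ge0 (s - t).
rewrite /ramp; case: (lerP 0 s) => s0; case: (lerP 0 t) => t0 H1 H2 H3; apply/andP; split; try lra.
- by have := mulr_ge0_le0 s0 (ltW t0); lra.
- by have := mulr_ge0_le0 t0 (ltW s0); lra.
Qed.

(** For [s] and [t] nonnegative the remainder is [(s - t)^2 * (3 t + (s - t))], and [|s - t| <= 1]
    yields the constant. *)
Lemma is_derive_ramp3 t :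
  is_derive (t : R^o) 1 (fun s : R^o => ramp s ^+ 3 : R^o) (3 * ramp t ^+ 2).
Proof.
apply: (@quadratic_is_derive _ _ _ (3 * ramp t + 1)) => [|s].
  by rewrite addr_ge0 // mulr_ge0 // ramp_ge0.
rewrite !ler_norml => /andP[s1 s2].
have d2 := sqr_ge0 (s - t); have s20 := sqr_ge0 s; have t20 := sqr_ge0 t.
rewrite /ramp; case: (lerP 0 s) => s0; case: (lerP 0 t) => t0; apply/andP; split.
- have d1 : 0 <= 1 + (s - t) by lra.
  have := mulr_ge0 d2 t0; have := mulr_ge0 d2 d1; lra.
- have d1 : 0 <= 1 - (s - t) by lra.
  have := mulr_ge0 d2 t0; have := mulr_ge0 d2 d1; lra.
- have := mulr_ge0 s20 s0; lra.
- have d1 : 0 <= 1 - s by lra.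
  have := mulr_ge0 s20 d1; have := mulr_ge0_le0 s0 (ltW t0); lra.
- have := mulr_ge0 t20 t0; have := mulr_ge0_le0 t20 (ltW s0).
  have := mulr_ge0 d2 t0; lra.
- have := mulr_ge0 t20 t0; have := mulr_ge0_le0 t20 (ltW s0).
  have := mulr_ge0 s20 t0; lra.
- lra.
- lra.
Qed.

Lemma ramp_continuous : continuous (ramp : R -> R).
Proof.
have -> : ramp = fun t => (t + `|t|) / 2.
  apply/funext => t; rewrite /ramp; case: (lerP 0 t) => t0.
    by rewrite ger0_norm //; field.
  by rewrite ltr0_norm // subrr mul0r.
move=> t; apply: cvgMl; apply: cvgD; first exact: cvg_id.
exact: norm_continuous.
Qed.

Lemma is_derive_shifted f l a t : is_derive (t - a : R^o) 1 (f : R^o -> R^o) l ->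
  is_derive (t : R^o) 1 (fun s : R^o => f (s - a) : R^o) l.
Proof.
move=> [d <-].
have D : has_diff (t : R^o) (fun s : R^o => s - a : R^o) id.
  have /has_diff_ext := has_diff_add (is_diff_id (t : R^o)) (has_diff_const (- a : R^o) (t : R^o)).
  by apply=> // h; rewrite addr0.
have F : has_diff (t - a : R^o) (f : R^o -> R^o) (fun h => 'D_h (f : R^o -> R^o) (t - a)).
  exact/has_diff_derive/derivable1_diffP.
have [e E] := has_diff_comp_fun D F.
by split; [exact: diff_derivable|rewrite deriveE // E].
Qed.

(** Affine of slope [- k] up to [T], where the value is [k + 1]. *)
Definition cutoff (k T t : R) : R := (k * T + k + 1) + - k * t + ramp (t - T) ^+ 3.

Lemma cutoff_derive k T t : is_derive (t : R^o) 1 (cutoff k T : R^o -> R^o)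
  (- k + 3 * ramp (t - T) ^+ 2).
Proof.
have D3 := is_derive_shifted (is_derive_ramp3 (t - T)).
have Dl : is_derive (t : R^o) 1 (fun s : R^o => (k * T + k + 1) + - k * s : R^o) (- k).
  by apply: (@quadratic_is_derive _ _ _ 0) => // s _; rewrite mul0r normr_le0; apply/eqP; ring.
exact: (@is_deriveD _ _ _ _ _ _ _ _ _ Dl D3).
Qed.

Lemma cutoff_C2 k T : C2_ge0 (cutoff k T).
Proof.
exists (fun t => - k + 3 * ramp (t - T) ^+ 2), (fun t => 6 * ramp (t - T)); split.
- by apply: is_derive_ge0 => t; exact: cutoff_derive.
- apply: is_derive_ge0 => t.
  have D2 := is_derive_shifted (is_derive_ramp2 (t - T)).
  have H := @is_deriveD _ _ _ _ _ _ _ _ _ (is_derive_cst (- k : R^o) (t : R^o) 1)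
    (@is_deriveZ _ _ _ _ (3 : R) _ _ _ D2).
  apply: (@is_derive_eq _ _ _ _ _ _ _ _ H).
  by rewrite add0r -[_ *: _]/(3 * (2 * ramp (t - T))); ring.
- apply: continuous_subspaceT => t; apply: cvgMr.
  apply: (@continuous_comp _ _ _ (fun s : R => s - T) ramp); last exact: ramp_continuous.
  by apply: cvgB; [exact: cvg_id|exact: cvg_cst].
Qed.

(** Up to [T + 1] the affine part is at least 1; beyond, the cube exceeds [t - T], hence also
    [k * (t - T)]. *)
Lemma cutoff_gt0 k T t : 0 <= k <= 1 -> 0 < cutoff k T t.
Proof.
move=> /andP[k0 k1]; rewrite /cutoff /ramp.
case: (lerP 0 (t - T)) => s0; last first.
  have Tt : 0 <= T - t by lra.
  by have := mulr_ge0 k0 Tt; rewrite expr0n /=; lra.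
have [s1|s1] := lerP (t - T) 1.
  have s1' : 0 <= 1 - (t - T) by lra.
  by have := exprn_ge0 3 s0; have := mulr_ge0 k0 s1'; lra.
have s3 : t - T <= (t - T) ^+ 3 by rewrite ler_eXnr // ltW.
have k1' : 0 <= 1 - k by lra.
by have := mulr_ge0 k1' s0; move: s3; set q := (t - T) ^+ 3; lra.
Qed.

Lemma C2_ge0_cst (a : R) : C2_ge0 (fun=> a).
Proof.
exists (fun=> 0), (fun=> 0); split; last exact/continuous_subspaceT/cst_continuous.
- by apply: is_derive_ge0 => t; exact: is_derive_cst.
- by apply: is_derive_ge0 => t; exact: is_derive_cst.
Qed.

End Cutoff.

(** * The norm of a Killing field *)

Section FieldNorm.
Context {R : realType} {n : nat}.
Variable xi : 'rV[R]_(1 + n) -> 'rV[R]_(1 + n).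
Hypothesis kxi : killing_field xi.
Implicit Types (sg : bool) (y X Y : 'rV[R]_n).

Definition chart_norm2 sg y : R := dot (xi (stereo sg y)) (xi (stereo sg y)).

Lemma norm2_section sg y : norm2 (section_map xi sg y) = chart_norm2 sg y.
Proof.
by rewrite /norm2 row_mxKl row_mxKr /chart_norm2 dot_components //; case: kxi.
Qed.

Lemma has_diff_chart_norm2 sg y :
  has_diff y (chart_norm2 sg : _ -> R^o) (fun h => 2 * conf y ^+ 2 *
    (dot ('D_h (components xi sg) y) (components xi sg y)
     + dot (psi y) h * dot (components xi sg y) (components xi sg y))).
Proof.
have Dv := smooth_has_diff (killing_chart_components sg kxi).1 y.
have /has_diff_ext := has_diff_mul (has_diff_conf2 y) (has_diff_dot Dv Dv).
apply=> h; first by rewrite /chart_norm2 dot_components //; case: kxi.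
rewrite (dotC (components xi sg y)).
move: (dot _ _) (dot _ _) (dot _ _) => a b c; ring.
Qed.

(** The change of charts is the inversion in the unit sphere. *)
Lemma stereo_inversion sg y : dot y y != 0 ->
  stereo (~~ sg) ((dot y y)^-1 *: y) = stereo sg y.
Proof.
move=> y0; have d1 : 1 + dot y y != 0 by rewrite gt_eqF // conf_den_gt0.
have d2 : dot y y + 1 != 0 by rewrite addrC.
rewrite /stereo dotZZ !scale_row_mx !scale_scalar_mx !scalerA.
have -> : (-1) ^+ (~~ sg) = - (-1) ^+ sg :> R by case: sg; rewrite ?expr0 ?expr1 ?opprK.
by congr row_mx; [congr (_%:M)|congr (_ *: _)]; field; rewrite ?d1 ?d2 ?y0.
Qed.

Lemma coord_sqr_le y i : y 0 i ^+ 2 <= dot y y.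
Proof.
rewrite dotE (bigD1 i) //= -expr2 lerDl sumr_ge0 // => j _.
by rewrite -expr2 sqr_ge0.
Qed.

(** The closed unit balls of the two charts cover the sphere, since inversion carries the outside of
    one into the other. *)
Lemma chart_norm2_bounded : exists T, forall sg y, chart_norm2 sg y < T.
Proof.
(* The cube is compact as a product of segments, and contains the unit ball. *)
pose B := [set y : 'rV[R]_n | forall i, `[(-1 : R), 1]%classic (y ord0 i)].
have cB : compact B.
  by apply: (@rV_compact R n (fun=> `[(-1 : R), 1]%classic)) => i; exact: segment_compact.
have inB y : dot y y <= 1 -> B y.
  move=> y1 i; rewrite /= in_itv /= -ler_norml -(@ler_pXn2r _ 2) ?nnegrE //.
  by rewrite real_normK ?num_real // expr1n (le_trans (coord_sqr_le y i)).
have B0 : B !=set0 by exists 0; apply: inB; rewrite dot0l.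
have M sg : exists m, forall y, B y -> chart_norm2 sg y <= m.
  have [|c _ H] := @EVT_max_rV R n (chart_norm2 sg) B B0 cB.
    apply: continuous_subspaceT => y; apply: differentiable_continuous.
    by have [] := has_diff_chart_norm2 sg y.
  by exists (chart_norm2 sg c) => y /mem_set /H.
have [m1 H1] := M true; have [m2 H2] := M false.
pose m := Num.max m1 m2.
have H sg y : dot y y <= 1 -> chart_norm2 sg y <= m.
  by case: sg => /inB yB; rewrite /m le_max; apply/orP; [left; exact: H1|right; exact: H2].
have {}H sg y : chart_norm2 sg y <= m.
  have [y1|y1] := lerP (dot y y) 1; first exact: H.
  have y0' : 0 < dot y y := lt_trans ltr01 y1.
  have y0 := lt0r_neq0 y0'.
  rewrite /chart_norm2 -(stereo_inversion sg y0); apply: H.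
  by rewrite dotZZ -mulrA mulVf // mulr1 invf_le1 // ltW.
(* The added 1 makes the bound strict. *)
by exists (m + 1) => sg y; rewrite (le_lt_trans (H sg y)) // ltrDl.
Qed.

Lemma derivative0_constant (f : 'rV[R]_n -> R^o) x y :
  (forall z, has_diff z f (fun=> 0)) -> f x = f y.
Proof.
move=> D; have /= := @is_derive_0_is_cst R (fun t => f (y + t *: (x - y))) 1 0.
rewrite scale1r scale0r addr0 subrKC; apply=> t.
exact: (is_derive_line (D _)).
Qed.

(** The assumption says that the differential of [chart_norm2] vanishes in each chart. The two
    constants agree because inversion fixes a unit vector. *)
Lemma constant_chart_norm2 : (0 < n)%N ->
  (forall sg y h, dot ('D_h (components xi sg) y) (components xi sg y)
     + dot (psi y) h * dot (components xi sg y) (components xi sg y) = 0) ->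
  exists c, forall sg y, chart_norm2 sg y = c.
Proof.
move=> n0 H.
have C sg x y : chart_norm2 sg x = chart_norm2 sg y.
  apply: (derivative0_constant (f := chart_norm2 sg)) => z.
  by have /has_diff_ext := has_diff_chart_norm2 sg z; apply=> // h; rewrite H mulr0.
exists (chart_norm2 true 0) => -[] y; first exact: C.
pose e : 'rV[R]_n := delta_mx 0 (Ordinal n0).
have ee : dot e e = 1 by rewrite dot_delta mxE !eqxx.
rewrite (C false y e) (C true 0 e) /chart_norm2 -(@stereo_inversion false e) ee ?oner_neq0 //.
by rewrite invr1 scale1r.
Qed.

End FieldNorm.

(** * Constant norm in even dimension *)

Section EvenDimension.
Context {R : realType} {n : nat}.

(** Transposition gives [\det N = (-1) ^+ m * \det N]. *)
Lemma skew_odd_det m (N : 'M[R]_m) : N^T = - N -> odd m -> \det N = 0.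
Proof.
move=> NT m1; have := det_tr N.
rewrite NT -scaleN1r detZ -signr_odd m1 expr1 mulN1r.
by move: (\det N) => t ?; lra.
Qed.

Variable v : 'rV[R]_n -> 'rV[R]_n.
Hypothesis kv : killing_chart v.
Hypothesis grad0 : forall y X, dot ('D_X v y) (v y) + dot (psi y) X * dot (v y) (v y) = 0.

Lemma psi_at0 : psi (0 : 'rV[R]_n) = 0. Proof. by rewrite /psi scaler0. Qed.

Lemma conf_at0 : conf (0 : 'rV[R]_n) = 2.
Proof. by rewrite /conf dot0l addr0 invr1 mulr1. Qed.

(** Derivative of [grad0] along [X] at the origin, where [psi] is 0 and [conf] is 2: the second
    derivative of [v] and the derivative of [psi] each contribute -2 times the product in the
    conclusion. *)
Lemma hessian_at0 X : dot (v 0) X = 0 -> 'D_X v 0 = 0 -> dot X X * dot (v 0) (v 0) = 0.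
Proof.
move=> vX DX.
have Dv := smooth_has_diff kv.1 0.
have D2 := smooth_derive_has_diff kv.1 0 X.
have H := has_diff_add (has_diff_dot D2 Dv) (has_diff_mul
  (has_diff_dot (has_diff_psi (0 : 'rV[R]_n)) (has_diff_const X 0)) (has_diff_dot Dv Dv)).
have H0 := has_diff_ext H (fun y => grad0 y X) (fun=> erefl).
have := has_diff_uniq X H0 (has_diff_const (0 : R^o) 0).
rewrite /= (killing_hessian kv) /dfactor DX psi_at0 conf_at0 !dot_lin (dotC X (v 0)) vX.
move: (dot _ _) (dot _ _) => a b E; lra.
Qed.

Lemma killing_zero_even : ~~ odd n -> v 0 = 0.
Proof.
move=> n2; have Dv := smooth_has_diff kv.1 0; have [_ D] := Dv.
apply/eqP/negPn/negP => v0; have vv := dot_gt0 v0.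
pose M : 'M[R]_n := \matrix_i 'D_(delta_mx 0 i) v 0.
have ME X : X *m M = 'D_X v 0.
  rewrite mulmx_sum_row -[RHS]/((fun h => 'D_h v 0) X) -D [in RHS](row_sum_delta X) linear_sum.
  by apply: eq_bigr => i _; rewrite linearZ rowK D.
have Dvv X : dot ('D_X v 0) (v 0) = 0.
  by have := grad0 0 X; rewrite psi_at0 dot0l mul0r addr0.
have MT : M^T = - M.
  apply/matrixP => i j; rewrite !mxE.
  have := kv.2 0 (delta_mx 0 i) (delta_mx 0 j).
  rewrite psi_at0 dot0l mulr0 mul0r !dot_deltar => /eqP.
  by rewrite addrC addr_eq0 => /eqP.
(* A kernel vector [(X, a)] of this bordered skew matrix satisfies ['D_X v 0 = a v] and is such that
   [X] is orthogonal to [v 0]. *)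
pose N : 'M[R]_(n + 1) := block_mx M (v 0)^T (- v 0) 0.
have NT : N^T = - N.
  by rewrite /N tr_block_mx MT trmxK linearN trmx0 opp_block_mx opprK oppr0.
have n1 : odd (n + 1) by rewrite addn1.
have /eqP /det0P[w w0 wN] := skew_odd_det NT n1.
move: wN w0; rewrite -(hsubmxK w); set X := lsubmx w; set a := rsubmx w.
rewrite mul_row_block mulmx0 addr0 => E.
have [E1 E2] : X *m M + a *m (- v 0) = 0 /\ X *m (v 0)^T = 0.
  by apply: eq_row_mx; rewrite row_mx0.
have aE : a *m v 0 = 'D_X v 0.
  by apply/eqP; rewrite -ME eq_sym -subr_eq0 -mulmxN E1.
have Xv : dot (v 0) X = 0 by rewrite dotC /dot E2 mxE.
(* Pair ['D_X v 0 = a v] with [v 0]: the left side gives 0 by [Dvv]. *)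
have a0 : a = 0.
  have := Dvv X; rewrite -aE (mx11_scalar a) mul_scalar_mx dotZl => /eqP.
  by rewrite mulf_eq0 (gt_eqF vv) orbF => /eqP ->; rewrite raddf0.
have DX : 'D_X v 0 = 0 by rewrite -aE a0 mul0mx.
have /eqP := hessian_at0 Xv DX; rewrite mulf_eq0 (gt_eqF vv) orbF dot_eq0 => /eqP ->.
by rewrite a0 row_mx0 eqxx.
Qed.

End EvenDimension.

(** * Choice of the metric and discussion by dimension *)

Theorem proposition7p2 (R : realType) (n : nat) (hn : (2 <= n)%N)
    (xi : 'rV[R]_(1 + n) -> 'rV[R]_(1 + n)) :
  killing_field xi -> nonzero_field xi ->
  exists (A B C : R -> R) (G : bool -> 'rV[R]_(n + n) -> 'M[R]_(n + n)),
    [/\ kaluza_klein_metric A B C G /\ harmonic_section G xi,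
        n = 2%N -> harmonic_map G xi,
        forall p : nat, (1 < p)%N -> n = (2 * p)%N -> ~ harmonic_map G xi
      & forall p : nat, n = (2 * p + 1)%N ->
          ~ constant_norm xi -> ~ harmonic_map G xi].
Proof.
move=> kxi [x0 x0S x0N].
have [T hT] := chart_norm2_bounded kxi.
(* With [A' = - k] the vertical coefficient [n A' + n - 1] vanishes, and the horizontal one is
   [1 - 2 * k]. *)
pose k : R := (n%:R - 1) / n%:R; pose A := cutoff k T.
have n0 : (n%:R : R) != 0 by rewrite pnatr_eq0 -lt0n (ltn_trans _ hn).
have n1 : 1 <= (n%:R : R) by rewrite ler1n (ltn_trans _ hn).
have k01 : 0 <= k <= 1.
  have n00 : 0 < (n%:R : R) by exact: lt_le_trans n1.
  by rewrite divr_ge0 ?subr_ge0 ?(ltW n00) // ler_pdivrMr // mul1r; lra.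
have A0 t : 0 <= t -> 0 < A t by move=> _; exact: cutoff_gt0.
(* The squared norm of [xi] stays below [T], where the ramp vanishes. *)
have DA sg y : is_derive (norm2 (section_map xi sg y) : R^o) 1 (A : R^o -> R^o) (- k).
  have := cutoff_derive k T (norm2 (section_map xi sg y)).
  rewrite /ramp subr_ge0 leNgt norm2_section // hT /=.
  by rewrite expr0n mulr0 addr0.
pose G (sg : bool) : 'rV[R]_(n + n) -> 'M[R]_(n + n) := kk_metric A.
have tauE sg y W : form (G sg (section_map xi sg y)) (tau G xi sg y) W =
    conf y ^+ 2 * ((1 - 2 * k) * (dot ('D_(lsubmx W) (components xi sg) y) (components xi sg y)
      + dot (psi y) (lsubmx W) * dot (components xi sg y) (components xi sg y))).
  rewrite [LHS](form_tension (killing_chart_components sg kxi) sg A0 (DA sg y)).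
  have -> : n%:R * - k + n%:R - 1 = 0 by rewrite /k; field.
  by rewrite mul0r subr0 mulrN addrC.
have eqs sg : kaluza_klein_eqs (sphere_metric sg) A (fun=> 1) (fun=> 0) (G sg).
  move=> z X Y gp e; rewrite !form_kk /gp /e sphere_metricE !form_scalar.
  rewrite /vpart /hlift /vlift !row_mxKl !row_mxKr sphere_connection !subrr.
  have -> : Gam (psi (lsubmx z)) 0 (rsubmx z) = 0.
    by rewrite /lc_form !dot0l dot0r scaler0 !scale0r subr0 addr0.
  rewrite !dot_lin !mulr0 !addr0 !add0r mul1r !mul0r ?addr0.
  by rewrite !oppr0 !(addr0, mulr0) /norm2 mulrA.
have riem sg : riemannian (G sg).
  by move=> z; split; [exact: kk_sym|move=> X; exact: kk_pos].
have secG : harmonic_section G xi.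
  move=> sg y; apply: dot_inj => q; rewrite dot0l.
  (* The right side of [tauE] sees only the horizontal component of its test vector, here 0; the
     left side is [conf y ^+ 2] times the product of [tau_v] with [q]. *)
  have := tauE sg y (vlift q).
  have [_ E1 E2] := eqs sg (section_map xi sg y) (tau_h G xi sg y) q.
  have [_ _ E3] := eqs sg (section_map xi sg y) (tau_v G xi sg y) q.
  have D0 : 'D_0 (components xi sg) y = 0 by rewrite derive0.
  rewrite tau_decomposition formDl E1 E3 add0r mul1r !mul0r addr0.
  rewrite /section_map !row_mxKl sphere_metricE form_scalar D0 dot0l dot0r mul0r addr0 !mulr0.
  by move/eqP; rewrite mulf_eq0 expf_eq0 (negbTE (conf_neq0 y)) => /eqP.
(* Test vectors [(h, 0)] suffice, as [1 - 2 * k = (2 - n) / n] is non-zero for [n > 2]. *)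
have grad : (2 < n)%N -> harmonic_map G xi -> forall sg y h,
    dot ('D_h (components xi sg) y) (components xi sg y)
    + dot (psi y) h * dot (components xi sg y) (components xi sg y) = 0.
  move=> n3 harm sg y h; have := tauE sg y (row_mx h 0).
  rewrite harm row_mxKl /form !mul0mx mxE => /esym/eqP.
  rewrite mulf_eq0 expf_eq0 (negbTE (conf_neq0 y)) /= mulf_eq0 => /orP[|/eqP //].
  have -> : 1 - 2 * k = (2 - n%:R) / n%:R by rewrite /k; field.
  rewrite mulf_eq0 invr_eq0 (negbTE n0) orbF subr_eq0 -[2 in X in X -> _]/(2%:R) eqr_nat.
  by move=> /eqP n2; rewrite -n2 in n3.
exists A, (fun=> 1), (fun=> 0), G; split.
- split=> //; split => //; split; [exact: cutoff_C2|exact: C2_ge0_cst|exact: C2_ge0_cst].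
(* For [n = 2] the right side of [tauE] is 0 for every [W]; with [W] the tension field itself, a
   non-zero value contradicts positivity. *)
- move=> n2 sg y; apply/eqP/negPn/negP => t0.
  have := kk_pos (section_map xi sg y) A0 t0; rewrite [form _ _ _](tauE sg y).
  have -> : 1 - 2 * k = 0 by rewrite /k n2; field.
  by rewrite mul0r mulr0 ltxx.
- move=> p p1 np harm.
  have n3 : (2 < n)%N by rewrite np -[X in (X < _)%N]muln1 ltn_pmul2l.
  have [c hc] := constant_chart_norm2 kxi (ltnW hn) (grad n3 harm).
  (* In even dimension the field vanishes at the origin of a chart, which fixes the constant. *)
  have c0 : c = 0.
    rewrite -(hc true 0) /chart_norm2 dot_components; last by case: kxi.
    rewrite (killing_zero_even (killing_chart_components true kxi) (grad n3 harm true)).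
      by rewrite dot0l mulr0.
    by rewrite np mul2n odd_double.
  have [sg [y E]] := stereo_surj x0S.
  by move: x0N; rewrite -dot_eq0 E -/(chart_norm2 xi sg y) hc c0 eqxx.
- move=> p np nconst harm.
  (* [n] is odd, so [2 <= n] is strict. *)
  have n3 : (2 < n)%N.
    rewrite ltn_neqAle hn andbT np; apply/eqP => /(congr1 odd).
    by rewrite addn1 /= mul2n odd_double.
  have [c hc] := constant_chart_norm2 kxi (ltnW hn) (grad n3 harm).
  apply: nconst; exists (Num.sqrt c) => x /stereo_surj[sg [y ->]].
  by rewrite -/(chart_norm2 xi sg y) hc.
Qed.
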